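(* Suppose that Assumptions A, B, C, D and E of the context hold (Assumption E fixes $\bar r\in(\tfrac12,1)$). Let $\Omega^*$ and $\psi^*$ be the solution set and the optimal value of problem (P). Assume there exist $\kappa>0$, $\theta\in(0,1)$, $\epsilon_0>0$ and $\epsilon_1\in(0,1)$ such that $$\mathrm{dist}(x,\Omega^* )\le\kappa(\psi(x)-\psi^* )^{1-\theta}$$ for all $x\in\Omega_0$ with $\mathrm{dist}(x,\Omega^* )\le\epsilon_0$ and $\psi(x)\le\psi^*+\epsilon_1$. Let $\{x^k\}$ be generated by the algorithm sMBA described in the context. Then $x^*:=\lim_{k\to\infty}x^k$ exists, and there exist $k_1\in\mathbb N_0$ and $\kappa_1>0$ such that $$\|x^k-x^*\|\le\kappa_1\,(k+1)^{-s}\qquad\forall k\ge k_1,$$ where $$s:=\begin{cases}\bar r-\frac12&\text{if }\theta\in(0,\frac12],\\[2pt]\min\left\{\bar r-\frac12,\ \frac{(1-\bar r)(1-\theta)}{2\theta-1}\right\}&\text{if }\theta\in(\frac12,1).\end{cases}$$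
   Context: **Notation.** $\mathbb X,\mathbb Y$ are finite-dimensional real Hilbert spaces; $\mathbb N_0=\mathbb N\cup\{0\}$ with $\mathbb N=\{1,2,\dots\}$. For a cone $\mathcal K\subseteq\mathbb Y$, $\mathcal K^\circ=\{y:\langle y,w\rangle\le0\ \forall w\in\mathcal K\}$. A map is $L$-smooth if it is continuously differentiable with $L$-Lipschitz derivative; $DG(x)$ is the derivative of $G$. $\partial$ is the convex subdifferential. $\sigma_{\mathcal C}(y)=\sup_{u\in\mathcal C}\langle y,u\rangle$ is the support function. A base of a cone $\mathcal Q$ is a convex set $\mathcal D$ with $0\notin\mathrm{cl}(\mathcal D)$ and $\mathcal Q=\bigcup_{t\ge0}t\mathcal D$. **Problem (P).** Minimize $\psi(x):=f(x)+P_1(x)-P_2(x)$ over $x\in\mathbb X$ subject to $G(x)\in\mathcal K$. **Assumption A.** (i) $\mathcal K\subseteq\mathbb Y$ is a closed convex pointed cone with nonempty interior. (ii) $f:\mathbb X\to\mathbb R$ is $L_f$-smooth and $G:\mathbb X\to\mathbb Y$ is $L_G$-smooth, $L_f>0$, $L_G\ge0$. (iii) $P_1,P_2:\mathbb X\to\mathbb R$ are convex. (iv) There is $x^0\in\mathbb X$ with $G(x^0)\in\mathrm{int}(\mathcal K)$ such that $\Omega_0:=\{x:\psi(x)\le\psi(x^0),\ G(x)\in\mathcal K\}$ is bounded. (v) (Robinson's constraint qualification) $0\in\mathrm{int}(G(x)+DG(x)\mathbb X-\mathcal K)$ for all $x\in\Omega_0$. $\mathcal B$ is a fixed compact base of $\mathcal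 K^\circ$ (one exists). **Assumption B.** There are $\alpha_1\ge0$, $\alpha_2,\alpha_3,\alpha_4>0$ and a family $\{h_\mu\}_{\mu>0}$ of convex $C^1$ functions on $\mathbb Y$ such that for every $\mu>0$, $\nabla h_\mu$ is $(\alpha_1+\alpha_2/\mu)$-Lipschitz and $\sigma_{\mathcal B}(y)\le h_\mu(y)\le\sigma_{\mathcal B}(y)+\alpha_3\mu$ for all $y\in\mathbb Y$; and $h_{\mu_1}(y)\le h_{\mu_0}(y)-\alpha_4(\mu_0-\mu_1)$ for all $y\in\mathbb Y$ and $\mu_0>\mu_1>0$. Put $g_\mu(x):=h_\mu(G(x))$. **Assumption C.** The sequence $\{\mu_k\}_{k\in\mathbb N_0}$ used in the algorithm is positive, strictly decreasing, $\mu_k\to0$, and $\sum_{k=\lceil K/2\rceil}^K\mu_k\to\infty$ as $K\to\infty$. **Assumption D.** $P_2=0$, $f$ is convex, and $G$ is $(-\mathcal K)$-convex, i.e. $\lambda G(x)+(1-\lambda)G(z)\in G(\lambda x+(1-\lambda)z)-\mathcal K$ for all $x,z\in\mathbb X$, $\lambda\in[0,1]$. **Assumption E.** There exist $\bar r\in(\frac12,1)$, $c_1>0$, $c_2>0$ and $\bar k_0\in\mathbb N_0$ such that $c_1(k+1)^{-\bar r}\le\mu_k\le c_2(k+1)^{-\bar r}$ for all $k\ge\bar k_0$. **Algorithm sMBA.** Input: $\tau_1,\tau_2>0$, $\hat L\ge\check L>0$, the point $x^0$ of Assumption A(iv), the family $\{h_\mu\}$. Step 1: find $\mu_0>0$ with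 $g_{\mu_0}(x^0)<0$; set $k=0$. Step 2: choose $\xi^k\in\partial P_2(x^k)$ and $L_f^{k,0},L_g^{k,0}\in[\check L,\hat L]$; set $i=j=0$. Step 3: set $L_f^{k,i}=2^iL_f^{k,0}$, $L_g^{k,j}=2^jL_g^{k,0}$; let $x^{k,i,j}$ be the unique solution, and $\lambda_{k,i,j}\ge0$ a Lagrange multiplier, of the problem of minimizing $\psi_{k,i}(x):=P_1(x)+\langle\nabla f(x^k)-\xi^k,x-x^k\rangle+\frac{L_f^{k,i}}2\|x-x^k\|^2$ subject to $g_{k,j}(x):=g_{\mu_k}(x^k)+\langle\nabla g_{\mu_k}(x^k),x-x^k\rangle+\frac{L_g^{k,j}}{2\mu_k}\|x-x^k\|^2\le0$. Step 4: if $g_{\mu_k}(x^{k,i,j})\le0$ and $\psi(x^{k,i,j})\le\psi(x^k)-\frac{\tau_1\mu_k+\tau_2\lambda_{k,i,j}}{2\mu_k}\|x^{k,i,j}-x^k\|^2$, set $i_k=i$, $j_k=j$ and go to Step 5; else if $g_{\mu_k}(x^{k,i,j})>0$, set $j\leftarrow j+1$ and go to Step 3; else set $i\leftarrow i+1$, $j\leftarrow j+1$ and go to Step 3. Step 5: set $x^{k+1}=x^{k,i_k,j_k}$, $\lambda_{k+1}=\lambda_{k,i_k,j_k}$, $L_f^k=L_f^{k,i_k}$, $L_g^k=L_g^{k,j_k}$; choose $\mu_{k+1}\in(0,\mu_k)$; $k\leftarrow k+1$; go to Step 2. *)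

(* Defs.v *)
From HB Require Import structures.
From mathcomp Require Import all_boot all_order all_algebra.
From mathcomp Require Import all_classical all_reals all_analysis.

Set Implicit Arguments.
Unset Strict Implicit.
Unset Printing Implicit Defensive.

Import Order.TTheory GRing.Theory Num.Theory.
Import numFieldNormedType.Exports.

Local Open Scope classical_set_scope.
Local Open Scope ring_scope.

(* A finite-dimensional real Hilbert space is a normed module whose norm is
   induced by the inner product [ip] and which is spanned by finitely many
   vectors; completeness is then automatic. *)
Definition fin_dim_hilbert (R : realType) (X : normedModType R)
    (ip : {dot X for idfun}) : Prop :=
  (forall x : X, `|x| ^+ 2 = ip x x) /\
  (exists (n : nat) (b : 'I_n -> X),
     forall x : X, exists c : 'I_n -> R, x = \sum_i c i *: b i).

Definition polar (R : realType) (Y : normedModType R) (ip : {dot Y for idfun})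
    (K : set Y) : set Y :=
  [set y | forall w, K w -> ip y w <= 0].

(* Real-valued, hence meaningful only for nonempty bounded [C]. *)
Definition support_function (R : realType) (Y : normedModType R)
    (ip : {dot Y for idfun}) (C : set Y) (y : Y) : R :=
  sup [set ip y u | u in C].

Definition subdifferential (R : realType) (X : normedModType R)
    (ip : {dot X for idfun}) (P : X -> R) (x : X) : set X :=
  [set xi | forall z, P x + ip xi (z - x) <= P z].

Definition is_cone (R : realType) (Y : normedModType R) (K : set Y) : Prop :=
  forall (t : R) (y : Y), 0 <= t -> K y -> K (t *: y).

Definition pointed_cone (R : realType) (Y : normedModType R) (K : set Y) :
    Prop :=
  forall y : Y, K y -> K (- y) -> y = 0.

Definition is_base (R : realType) (Y : normedModType R) (D Q : set Y) : Prop :=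
  [/\ @convex_set R Y D,
      ~ closure D 0 &
      Q = [set y | exists2 t : R, 0 <= t & exists2 u, D u & y = t *: u] ].

(* The second clause is the Lipschitz condition on x |-> 'd F x in operator
   norm; it entails that F is continuously differentiable. *)
Definition L_smooth (R : realType) (U V : normedModType R) (L : R)
    (F : U -> V) : Prop :=
  (forall x, differentiable F x) /\
  (forall x z d, `|'d F x d - 'd F z d| <= L * `|x - z| * `|d|).

Definition convex_on_space (R : realType) (X : normedModType R)
    (F : X -> R) : Prop :=
  @convex_function R X setT F.

Definition dist (R : realType) (X : normedModType R) (x : X) (A : set X) : R :=
  inf [set `|x - z| | z in A].

Definition argmin (R : realType) (X : normedModType R) (A : set X)
    (F : X -> R) : set X :=
  [set x | A x /\ forall z, A z -> F x <= F z].

(* KKT multiplier of the convex program "minimize F subject to g <= 0". *)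
Definition lagrange_multiplier (R : realType) (X : normedModType R)
    (ip : {dot X for idfun}) (F g : X -> R) (x : X) (lam : R) : Prop :=
  [/\ 0 <= lam,
      lam * g x = 0 &
      subdifferential ip (fun z => F z + lam * g z) x 0].

Record problem (R : realType) (X Y : normedModType R) := Problem {
  pb_f : X -> R;
  pb_P1 : X -> R;
  pb_P2 : X -> R;
  pb_G : X -> Y;
  pb_K : set Y }.

Definition psi (R : realType) (X Y : normedModType R) (p : problem X Y)
    (x : X) : R :=
  pb_f p x + pb_P1 p x - pb_P2 p x.

Definition feasible (R : realType) (X Y : normedModType R)
    (p : problem X Y) : set X :=
  [set x | pb_K p (pb_G p x)].

Definition Omega0 (R : realType) (X Y : normedModType R) (p : problem X Y)
    (x0 : X) : set X :=
  [set x | psi p x <= psi p x0 /\ feasible p x].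

Definition solution_set (R : realType) (X Y : normedModType R)
    (p : problem X Y) : set X :=
  argmin (feasible p) (psi p).

Definition optimal_value (R : realType) (X Y : normedModType R)
    (p : problem X Y) : R :=
  inf [set psi p x | x in feasible p].

Definition robinson_cq (R : realType) (X Y : normedModType R)
    (p : problem X Y) (x : X) : Prop :=
  interior [set y | exists d w,
    pb_K p w /\ y = pb_G p x + 'd (pb_G p) x d - w] 0.

Record assumption_A (R : realType) (X Y : normedModType R) (p : problem X Y)
    (x0 : X) (Lf LG : R) : Prop := {
  A_closed : closed (pb_K p);
  A_convex : @convex_set R Y (pb_K p);
  A_cone : is_cone (pb_K p);
  A_pointed : pointed_cone (pb_K p);
  A_solid : interior (pb_K p) !=set0;
  A_Lf : 0 < Lf;
  A_LG : 0 <= LG;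
  A_f : L_smooth Lf (pb_f p);
  A_G : L_smooth LG (pb_G p);
  A_P1 : convex_on_space (pb_P1 p);
  A_P2 : convex_on_space (pb_P2 p);
  A_x0 : interior (pb_K p) (pb_G p x0);
  A_bounded : bounded_set (Omega0 p x0);
  A_robinson : forall x, Omega0 p x0 x -> robinson_cq p x }.

(* [h mu] is only constrained for mu > 0. *)
Record assumption_B (R : realType) (Y : normedModType R)
    (ip : {dot Y for idfun}) (B : set Y) (h : R -> Y -> R)
    (alpha1 alpha2 alpha3 alpha4 : R) : Prop := {
  B_alpha1 : 0 <= alpha1;
  B_alpha2 : 0 < alpha2;
  B_alpha3 : 0 < alpha3;
  B_alpha4 : 0 < alpha4;
  B_convex : forall mu, 0 < mu -> convex_on_space (h mu);
  B_smooth : forall mu, 0 < mu -> L_smooth (alpha1 + alpha2 / mu) (h mu);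
  B_lower : forall mu y, 0 < mu -> support_function ip B y <= h mu y;
  B_upper : forall mu y, 0 < mu ->
    h mu y <= support_function ip B y + alpha3 * mu;
  B_mono : forall mu0 mu1 y, 0 < mu1 -> mu1 < mu0 ->
    h mu1 y <= h mu0 y - alpha4 * (mu0 - mu1) }.

(* [uphalf K] is the ceiling of K / 2. *)
Record assumption_C (R : realType) (mu : nat -> R) : Prop := {
  C_pos : forall k, 0 < mu k;
  C_decr : forall k, mu k.+1 < mu k;
  C_lim : mu k @[k --> \oo] --> 0;
  C_sum : \sum_(uphalf K <= k < K.+1) mu k @[K --> \oo] --> +oo }.

Record assumption_D (R : realType) (X Y : normedModType R)
    (p : problem X Y) : Prop := {
  D_P2 : forall x, pb_P2 p x = 0;
  D_f : convex_on_space (pb_f p);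
  D_G : forall (x z : X) (t : R), 0 <= t -> t <= 1 ->
    exists2 w, pb_K p w &
      t *: pb_G p x + (1 - t) *: pb_G p z =
      pb_G p (t *: x + (1 - t) *: z) - w }.

Definition assumption_E (R : realType) (mu : nat -> R) (r : R) : Prop :=
  [/\ 2^-1 < r, r < 1 &
      exists (c1 c2 : R) (k0 : nat), [/\ 0 < c1, 0 < c2 &
        forall k, (k0 <= k)%N ->
          c1 * (k.+1%:R `^ (- r)) <= mu k /\
          mu k <= c2 * (k.+1%:R `^ (- r))]].

Definition error_bound (R : realType) (X Y : normedModType R)
    (p : problem X Y) (x0 : X) (kappa theta eps0 eps1 : R) : Prop :=
  forall x, Omega0 p x0 x ->
    dist x (solution_set p) <= eps0 ->
    psi p x <= optimal_value p + eps1 ->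
    dist x (solution_set p) <=
      kappa * ((psi p x - optimal_value p) `^ (1 - theta)).

Definition g_smoothed (R : realType) (X Y : normedModType R)
    (p : problem X Y) (h : R -> Y -> R) (mu : R) (x : X) : R :=
  h mu (pb_G p x).

(* In the two models the gradient enters through its Riesz form
   <grad F(xk), d> = 'd F xk d. *)
Definition model_objective (R : realType) (X Y : normedModType R)
    (ip : {dot X for idfun}) (p : problem X Y) (xk xik : X) (L : R)
    (x : X) : R :=
  pb_P1 p x + ('d (pb_f p) xk (x - xk) - ip xik (x - xk))
  + L / 2 * `|x - xk| ^+ 2.

Definition model_constraint (R : realType) (X Y : normedModType R)
    (p : problem X Y) (h : R -> Y -> R) (mu : R) (xk : X) (L : R)
    (x : X) : R :=
  g_smoothed p h mu xk + 'd (g_smoothed p h mu) xk (x - xk)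
  + L / (2 * mu) * `|x - xk| ^+ 2.

(* The trial pairs (i, j) examined by a backtracking loop that stops as soon as
   [accept i j], increments j alone when [infeas i j], and increments both
   indices otherwise. *)
Inductive visited (accept infeas : nat -> nat -> Prop) : nat -> nat -> Prop :=
| visited_start : visited accept infeas 0 0
| visited_j i j : visited accept infeas i j ->
    ~ accept i j -> infeas i j -> visited accept infeas i j.+1
| visited_ij i j : visited accept infeas i j ->
    ~ accept i j -> ~ infeas i j -> visited accept infeas i.+1 j.+1.

(* [it_trial k i j] and [it_lam k i j] are the trial point and its multiplier;
   they are meaningful only for visited (i, j). *)
Record iterates (R : realType) (X : normedModType R) := Iterates {
  it_x : nat -> X;
  it_xi : nat -> X;
  it_mu : nat -> R;
  it_Lf0 : nat -> R;
  it_Lg0 : nat -> R;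
  it_trial : nat -> nat -> nat -> X;
  it_lam : nat -> nat -> nat -> R;
  it_i : nat -> nat;
  it_j : nat -> nat }.

Definition trial_infeasible (R : realType) (X Y : normedModType R)
    (p : problem X Y) (h : R -> Y -> R) (s : iterates X) (k i j : nat) :
    Prop :=
  0 < g_smoothed p h (it_mu s k) (it_trial s k i j).

Definition trial_accepted (R : realType) (X Y : normedModType R)
    (p : problem X Y) (h : R -> Y -> R) (tau1 tau2 : R) (s : iterates X)
    (k i j : nat) : Prop :=
  g_smoothed p h (it_mu s k) (it_trial s k i j) <= 0 /\
  psi p (it_trial s k i j) <=
    psi p (it_x s k)
    - (tau1 * it_mu s k + tau2 * it_lam s k i j) / (2 * it_mu s k)
      * `|it_trial s k i j - it_x s k| ^+ 2.

Definition trial_visited (R : realType) (X Y : normedModType R)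
    (p : problem X Y) (h : R -> Y -> R) (tau1 tau2 : R) (s : iterates X)
    (k : nat) : nat -> nat -> Prop :=
  visited (trial_accepted p h tau1 tau2 s k) (trial_infeasible p h s k).

Definition trial_objective (R : realType) (X Y : normedModType R)
    (ip : {dot X for idfun}) (p : problem X Y) (s : iterates X)
    (k i : nat) : X -> R :=
  model_objective ip p (it_x s k) (it_xi s k) (2 ^+ i * it_Lf0 s k).

Definition trial_constraint (R : realType) (X Y : normedModType R)
    (p : problem X Y) (h : R -> Y -> R) (s : iterates X) (k j : nat) :
    X -> R :=
  model_constraint p h (it_mu s k) (it_x s k) (2 ^+ j * it_Lg0 s k).

Record sMBA_run (R : realType) (X Y : normedModType R)
    (ip : {dot X for idfun}) (p : problem X Y) (h : R -> Y -> R)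
    (x0 : X) (tau1 tau2 Lmin Lmax : R) (s : iterates X) : Prop := {
  run_init : it_x s 0%N = x0;
  run_mu0 : 0 < it_mu s 0%N;
  run_g0 : g_smoothed p h (it_mu s 0%N) x0 < 0;
  run_xi : forall k, subdifferential ip (pb_P2 p) (it_x s k) (it_xi s k);
  run_Lf0 : forall k, Lmin <= it_Lf0 s k <= Lmax;
  run_Lg0 : forall k, Lmin <= it_Lg0 s k <= Lmax;
  run_trial : forall k i j, trial_visited p h tau1 tau2 s k i j ->
    argmin [set x | trial_constraint p h s k j x <= 0]
      (trial_objective ip p s k i) (it_trial s k i j);
  run_lam : forall k i j, trial_visited p h tau1 tau2 s k i j ->
    lagrange_multiplier ip (trial_objective ip p s k i)
      (trial_constraint p h s k j) (it_trial s k i j) (it_lam s k i j);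
  run_stop_visited : forall k,
    trial_visited p h tau1 tau2 s k (it_i s k) (it_j s k);
  run_stop_accepted : forall k,
    trial_accepted p h tau1 tau2 s k (it_i s k) (it_j s k);
  run_next : forall k, it_x s k.+1 = it_trial s k (it_i s k) (it_j s k);
  run_mu : forall k, 0 < it_mu s k.+1 < it_mu s k }.

Definition rate_exponent (R : realType) (r theta : R) : R :=
  if theta <= 2^-1 then r - 2^-1
  else Num.min (r - 2^-1) ((1 - r) * (1 - theta) / (2 * theta - 1)).

(* Main.v *)
(* Write [e_k = psi (x_k) - psi^*] and let [M_k = L_f^k + lam_{k+1} L_g^k / mu_k]
   be the curvature of the Lagrangian of the k-th subproblem. Strong convexity at
   its minimizer [x_{k+1}], together with convexity of [f] and [g_mu], gives for
   every [z]
     psi (x_{k+1}) + M_k/2 |z - x_{k+1}|^2 <=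
       psi z + lam_{k+1} g_{mu_k} z + M_k/2 |z - x_k|^2 + L_f |x_{k+1} - x_k|^2,
   while sufficient decrease and bounded backtracking give
   [c M_k |x_{k+1} - x_k|^2 <= e_k - e_{k+1}].

   With [z = x_0], where [g_mu] is bounded away from [0], either
   [e_k - e_{k+1} > mu_k] or [lam_{k+1}] is bounded. With [z] a solution near
   [x_k] (error bound), [g_{mu_k} z <= alpha3 mu_k] and therefore
     e_k <= C mu_k   or   e_{k+1} <= e_k - c mu_k e_k^(2 theta),
   which yields a power rate for [e_k] when [theta > 1/2]; smaller [theta] are
   weakened to [1 / (2 r)]. No bound on [lam] is needed to deduce
     |z - x_{k+1}|^2 <= |z - x_k|^2 + T mu_k^2 + S (e_k - e_{k+1})
   for solutions [z], since [lam_{k+1} mu_k / M_k <= mu_k^2 / L_g^k]; summing,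
   with [sum_{i >= k} mu_i^2 = O(k^(1 - 2 r))], bounds [|x_m - x_k|] for [m >= k]. *)
Require Import Defs.
From HB Require Import structures.
From mathcomp Require Import all_boot all_order all_algebra.
From mathcomp Require Import all_classical all_reals all_analysis.
From mathcomp Require Import ring lra.

Set Implicit Arguments.
Unset Strict Implicit.
Unset Printing Implicit Defensive.

Import Order.TTheory GRing.Theory Num.Theory.
Import numFieldNormedType.Exports.

Local Open Scope classical_set_scope.
Local Open Scope ring_scope.

(** * Inner products and convexity *)

Section InnerProduct.
Context (R : realType) (X : normedModType R) (ip : {dot X for idfun}).

Lemma ipC x y : ip x y = ip y x.
Proof. by rewrite hermC expr0 mul1r. Qed.

Lemma ipDl x y z : ip (x + y) z = ip x z + ip y z.
Proof. exact: linearDl. Qed.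

Lemma ipNl x z : ip (- x) z = - ip x z.
Proof. exact: linearNl. Qed.

Lemma ipZl a x z : ip (a *: x) z = a * ip x z.
Proof. exact: linearZl_LR. Qed.

Lemma ipDr x y z : ip z (x + y) = ip z x + ip z y.
Proof. by rewrite !(ipC z) ipDl. Qed.

Lemma ipNr x z : ip z (- x) = - ip z x.
Proof. by rewrite !(ipC z) ipNl. Qed.

Lemma ipZr a x z : ip z (a *: x) = a * ip z x.
Proof. by rewrite !(ipC z) ipZl. Qed.

Lemma ip0r z : ip z 0 = 0.
Proof. by rewrite -(scale0r (0 : X)) ipZr mul0r. Qed.

Lemma ip0l z : ip 0 z = 0.
Proof. by rewrite ipC ip0r. Qed.

Context (hn : forall x : X, `|x| ^+ 2 = ip x x).

Lemma normD2 (x y : X) : `|x + y| ^+ 2 = `|x| ^+ 2 + 2 * ip x y + `|y| ^+ 2.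
Proof. by rewrite !hn !ipDl !ipDr (ipC y x); ring. Qed.

Lemma normB2 (x y : X) : `|x - y| ^+ 2 = `|x| ^+ 2 - 2 * ip x y + `|y| ^+ 2.
Proof. by rewrite normD2 ipNr normrN; ring. Qed.

(** Cauchy-Schwarz: expand the nonnegative square of [|y| *: x - |x| *: y] and divide by the product
    of the norms. *)
Lemma ip_le_norm (x y : X) : ip x y <= `|x| * `|y|.
Proof.
have [->|x0] := eqVneq x 0; first by rewrite ip0l normr0 mul0r.
have [->|y0] := eqVneq y 0; first by rewrite ip0r normr0 mulr0.
have px : 0 < `|x| by rewrite normr_gt0.
have py : 0 < `|y| by rewrite normr_gt0.
have := sqr_ge0 `| `|y| *: x - `|x| *: y |.
rewrite normB2 !normrZ !normr_id ipZl ipZr => H.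
have pxy : 0 < `|x| * `|y| by rewrite mulr_gt0.
rewrite -(ler_pM2l pxy); nra.
Qed.

Lemma ip_norm (x y : X) : `|ip x y| <= `|x| * `|y|.
Proof.
by rewrite ler_norml ip_le_norm andbT lerNl -ipNl -(normrN x) ip_le_norm.
Qed.

(** Being an identity, this shows that the squared norm is strongly convex with an exactly known
    defect, which is what [strong_min] exploits. *)
Lemma norm_conv2 (t : R) (x y c : X) :
  `|t *: x + (1 - t) *: y - c| ^+ 2 =
  t * `|x - c| ^+ 2 + (1 - t) * `|y - c| ^+ 2 - t * (1 - t) * `|x - y| ^+ 2.
Proof.
have -> : t *: x + (1 - t) *: y - c = t *: (x - c) + (1 - t) *: (y - c).
  by rewrite !scalerBr addrACA -opprD -scalerDl [t + _]addrC subrK scale1r.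
have -> : x - y = (x - c) - (y - c) by rewrite opprB addrA subrK.
rewrite (normD2 (t *: _)) (normB2 (x - c)) !normrZ !exprMn.
by rewrite !real_normK ?num_real// ipZl ipZr; ring.
Qed.

End InnerProduct.

(** * Convex functions and quadratically regularized minimizers *)

Section Convex.
Context (R : realType) (X : normedModType R).
Implicit Types F : X -> R.

Lemma convex_on_spaceP F : convex_on_space F <->
  forall (t : R) (x y : X), 0 <= t -> t <= 1 ->
    F (t *: x + (1 - t) *: y) <= t * F x + (1 - t) * F y.
Proof.
split=> [cF t x y t0 t1|cF t x y _ _]; last exact: cF.
have [p ->] : exists p : {i01 R}, t = p%:num.
  have tP : t \in `[0, 1] by rewrite in_itv/= t0 t1.
  by exists (@Itv01 _ t t0 t1).
by apply: (cF p); rewrite in_setT.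
Qed.

Lemma convex_setP (A : set X) : @convex_set R X A <->
  forall (t : R) (x y : X), 0 <= t -> t <= 1 -> A x -> A y ->
    A (t *: x + (1 - t) *: y).
Proof.
split=> [cA t x y t0 t1 Ax Ay|cA x y t /set_mem Ax /set_mem Ay].
  exact: set_mem (cA x y (@Itv01 _ t t0 t1) (mem_set Ax) (mem_set Ay)).
by apply: mem_set; apply: cA.
Qed.

Lemma convex_onD F G : convex_on_space F -> convex_on_space G ->
  convex_on_space (fun x => F x + G x).
Proof.
move=> /convex_on_spaceP cF /convex_on_spaceP cG.
by apply/convex_on_spaceP => t x y t0 t1; have := cF t x y t0 t1;
  have := cG t x y t0 t1; lra.
Qed.

(* On the segment from [x] to [z], strong convexity improves the minimality
   inequality by [t M |z - x|^2] up to a term of order [t^2]; let t -> 0. *)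
Lemma strong_min (ip : {dot X for idfun}) (hn : forall x : X, `|x| ^+ 2 = ip x x)
    F (M : R) (c x : X) : convex_on_space F -> 0 <= M ->
  (forall z, F x + M * `|x - c| ^+ 2 <= F z + M * `|z - c| ^+ 2) ->
  forall z, F x + M * `|x - c| ^+ 2 + M * `|z - x| ^+ 2 <= F z + M * `|z - c| ^+ 2.
Proof.
move=> /convex_on_spaceP cF M0 xmin z.
set N := M * `|z - x| ^+ 2.
have N0 : 0 <= N by rewrite mulr_ge0// sqr_ge0.
rewrite leNgt; apply/negP => lt.
set g := F x + M * `|x - c| ^+ 2 + N - (F z + M * `|z - c| ^+ 2).
have g0 : 0 < g by rewrite subr_gt0.
(* One explicit [t] replaces the limit: minimality along the segment gives [g <= t * N], whereas
   this choice makes [t * N = g - t * g < g]. *)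
pose t := g / (g + N).
have gN : 0 < g + N by rewrite ltr_wpDr.
have t0 : 0 < t by rewrite divr_gt0.
have t1 : t <= 1 by rewrite ler_pdivrMr// mul1r lerDl.
have := xmin (t *: z + (1 - t) *: x).
rewrite (norm_conv2 hn); have := cF t z x (ltW t0) t1.
have tE : t * (g + N) = g by rewrite divfK// gt_eqF.
move=> h1 h2.
have h3 : t * g <= t * (t * N) by rewrite /g /N; nra.
rewrite ler_pM2l// in h3.
have := mulr_gt0 t0 g0; nra.
Qed.

End Convex.

(** * Finite dimension *)

Section FiniteDimension.
Context (R : realType) (X : normedModType R).

Lemma lin_comb_continuous m (a : 'I_m -> X) :
  continuous (fun c : 'rV[R]_m => \sum_i c ord0 i *: a i).
Proof.
apply: continuous_big => [|i _ c]; first exact: add_continuous.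
apply: (@cvgZr_tmp _ _ _ (nbhs c) _ (fun c : 'rV[R]_m => c ord0 i)).
exact: (@coord_continuous R 1 m ord0 i c).
Qed.

Definition spanned (n : nat) (b : 'I_n -> X) :=
  forall x : X, exists c : 'I_n -> R, x = \sum_i c i *: b i.

(* A spanning family of minimal length is linearly independent. *)
Lemma exists_basis (n : nat) (b : 'I_n -> X) : spanned b ->
  exists (m : nat) (a : 'I_m -> X), spanned a /\
    forall c : 'I_m -> R, \sum_i c i *: a i = 0 -> forall i, c i = 0.
Proof.
move=> sb.
pose P m := `[< exists a : 'I_m -> X, spanned a >].
have exP : exists m, P m by exists n; apply/asboolP; exists b.
case: (ex_minnP exP) => m /asboolP[a sa] mmin.
exists m, a; split => // c c0 j.
apply/eqP; apply/negPn/negP => cj0.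
case: m a sa mmin c c0 j cj0 => [|m] a sa mmin c c0 j cj0; first by case: j cj0.
suff /mmin : P m by rewrite ltnn.
apply/asboolP; exists (fun i => a (lift j i)) => x.
have [d ->] := sa x.
exists (fun i => d (lift j i) - d j / c j * c (lift j i)).
under [RHS]eq_bigr do rewrite scalerBl.
rewrite sumrB (bigD1_ord j)//= [LHS]addrC; congr (_ + _).
move: c0; rewrite (bigD1_ord j)//= => /eqP; rewrite addr_eq0 => /eqP E.
under eq_bigr do rewrite -scalerA.
rewrite -scaler_sumr -[X in _ = - (_ *: X)]opprK -E.
by rewrite scalerN opprK scalerA divfK.
Qed.

(** Equivalence of norms: for an independent family the norm of the combination attains a minimum on
    the compact unit sphere of coefficients, positive by independence; homogeneity extends the
    bound. *)
Lemma exists_coord_bound (n : nat) (b : 'I_n -> X) : spanned b ->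
  exists (m : nat) (a : 'I_m -> X) (C : R), spanned a /\ 0 < C /\
    forall c : 'rV[R]_m, `|c| <= C * `| \sum_i c ord0 i *: a i |.
Proof.
move=> /exists_basis[m [a [sa ia]]].
exists m, a.
pose T (c : 'rV[R]_m) := \sum_i c ord0 i *: a i.
have Tc : continuous T.
  exact: lin_comb_continuous.
pose S := [set c : 'rV[R]_m | `|c| = 1].
(* An empty unit sphere leaves only the zero coefficient vector, so any constant works. *)
have [[c0 Sc0]|S0] := pselect (S !=set0); last first.
  exists 1; split => //; split => // c; rewrite mul1r.
  have [->|c0] := eqVneq c 0; first by rewrite normr0.
  exfalso; apply: S0; exists (`|c|^-1 *: c).
  by rewrite /S/= normrZ normfV normr_id mulVf// normr_eq0.
have cS : compact S.
  apply: bounded_closed_compact.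
    by exists 1; split => // y y1 x /= ->; exact: ltW.
  have -> : S = (fun c : 'rV[R]_m => `|c|) @^-1` [set 1] by [].
  apply: closed_comp; last exact: closed_eq.
  by move=> x _; exact: norm_continuous.
have nTc : continuous (fun c => `|T c|).
  by move=> c; apply: (@cvg_norm _ _ _ (nbhs c) _ T); have := Tc c.
have Sn : S !=set0 by exists c0.
have [c1 Sc1 min1] := compact_EVT_min Sn cS (continuous_subspaceT nTc).
rewrite inE in Sc1.
have m0 : 0 < `|T c1|.
  rewrite normr_gt0; apply/eqP => /(ia (fun i => c1 ord0 i)) c10.
  move: Sc1; rewrite /S/=; have -> : c1 = 0.
    by apply/rowP => i; rewrite c10 mxE.
  by rewrite normr0 => /esym/eqP; rewrite oner_eq0.
exists (`|T c1|^-1); split => //; split; first by rewrite invr_gt0.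
move=> c; have [->|c0'] := eqVneq c 0.
  by rewrite normr0 mulr_ge0// invr_ge0.
have nc : 0 < `|c| by rewrite normr_gt0.
rewrite mulrC ler_pdivlMr// mulrC.
have := min1 (`|c|^-1 *: c); rewrite inE /S/= normrZ normfV normr_id mulVf ?gt_eqF//.
move=> /(_ erefl).
have -> : T (`|c|^-1 *: c) = `|c|^-1 *: T c.
  by rewrite /T scaler_sumr; apply: eq_bigr => i _; rewrite mxE scalerA.
by rewrite normrZ normfV normr_id mulrC ler_pdivlMr.
Qed.

Context (n : nat) (b : 'I_n -> X) (sb : spanned b).

(** Heine-Borel, transported from coordinates: [A] is the continuous image of its preimage, which is
    closed, and bounded by the coordinate estimate. *)
Lemma fin_dim_compact (A : set X) : bounded_set A -> closed A -> compact A.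
Proof.
move=> bA cA.
have [m [a [C [sa [C0 hC]]]]] := exists_coord_bound sb.
pose T (c : 'rV[R]_m) := \sum_i c ord0 i *: a i.
have Tc : continuous T.
  exact: lin_comb_continuous.
have -> : A = T @` (T @^-1` A).
  apply/seteqP; split => [x Ax|x [c Ac <-]//].
  have [c xE] := sa x; exists (\row_i c i).
    by rewrite /= /T; under eq_bigr do rewrite mxE; rewrite -xE.
  by rewrite /T; under eq_bigr do rewrite mxE; rewrite -xE.
apply: continuous_compact; first exact: continuous_subspaceT.
apply: bounded_closed_compact; last by apply: closed_comp => // x _; exact: Tc.
have [M [_ hM]] := bA.
exists (C * (`|M| + 1)); split; first by rewrite num_real.
move=> y yM c Ac; apply: (le_trans (hC c)).
apply: le_trans (ltW yM); rewrite ler_pM2l//.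
by apply: (hM (`|M| + 1)) => //; rewrite (le_lt_trans (ler_norm _))// ltrDl.
Qed.

Lemma convex_bounded_above (F : X -> R) (rho : R) : convex_on_space F ->
  exists M, forall x, `|x| <= rho -> F x <= M.
Proof.
move=> /convex_on_spaceP cF.
have [m [a [C [sa [C0 hC]]]]] := exists_coord_bound sb.
(* Induction on the number of generators. [S + c *: v] is the midpoint of [2 *: S], covered by the
   induction hypothesis at twice the radius, and of [2 *: (c *: v)], which lies on a fixed segment
   and is controlled by the endpoint values. *)
suff H : forall k (u : 'I_k -> X) (rho : R), exists M, forall c : 'I_k -> R,
    (forall i, `|c i| <= rho) -> F (\sum_i c i *: u i) <= M.
  have [M hM] := H m a (C * rho); exists M => x xr.
  have [c xE] := sa x; rewrite xE; apply: hM => i.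
  have := hC (\row_i c i); under eq_bigr do rewrite mxE; rewrite -xE => h.
  have -> : c i = (\row_i c i) ord0 i by rewrite mxE.
  apply: le_trans (le_trans h _); last by rewrite ler_pM2l.
  rewrite [leRHS]/Num.norm/= mx_normrE; apply/bigmax_geP; right => /=.
  by exists (ord0, i).
move=> {hC sa} k; elim: k => [|k IH] u r0.
  by exists (F 0) => c _; rewrite big_ord0.
have [M hM] := IH (fun i => u (widen_ord (leqnSn k) i)) (2 * r0).
pose v := u ord_max; pose r := `|r0| + 1.
have r_gt0 : 0 < r by rewrite /r ltr_wpDl.
exists (M + `|F ((2 * r) *: v)| + `|F (- (2 * r) *: v)| + `|M|) => c hc.
set a1 := F ((2 * r) *: v); set a2 := F (- (2 * r) *: v).
have hcr : `|c ord_max| <= r.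
  by apply: le_trans (hc _) _; rewrite (le_trans (ler_norm _))// lerDl.
rewrite big_ord_recr/= -/v.
set S := \sum_(i < k) _.
have -> : S + c ord_max *: v = 2^-1 *: (2 *: S) + (1 - 2^-1) *: (2 *: (c ord_max *: v)).
  have -> : 1 - 2^-1 = 2^-1 :> R by lra.
  by rewrite !scalerA ?mulrA mulVf// ?mul1r ?scale1r.
have h20 : (0 : R) <= 2^-1 by lra.
have h21 : (2^-1 : R) <= 1 by lra.
apply: le_trans (cF _ _ _ h20 h21) _.
have hS : F (2 *: S) <= M.
  rewrite /S scaler_sumr; under eq_bigr do rewrite scalerA.
  apply: (hM (fun i => 2 * c (widen_ord (leqnSn k) i))) => i.
  by rewrite normrM ger0_norm// ler_pM2l.
have hv : F (2 *: (c ord_max *: v)) <= `|a1| + `|a2|.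
  pose t := (c ord_max + r) / (2 * r).
  have r2 : 0 < 2 * r by rewrite mulr_gt0.
  move: hcr; rewrite ler_norml => /andP[c1 c2].
  have t0 : 0 <= t by rewrite divr_ge0//; lra.
  have t1 : t <= 1 by rewrite ler_pdivrMr//; lra.
  have -> : 2 *: (c ord_max *: v) = t *: ((2 * r) *: v) + (1 - t) *: (- (2 * r) *: v).
    rewrite !scalerA -scalerDl; congr (_ *: _); rewrite /t.
    by field; rewrite gt_eqF.
  apply: le_trans (cF _ _ _ t0 t1) _.
  have := ler_norm a1; have := ler_norm a2; have := normr_ge0 a1.
  have := normr_ge0 a2; rewrite -/a1 -/a2; nra.
have := ler_norm M; have := ler_norm (- M); rewrite normrN.
have := normr_ge0 a1; have := normr_ge0 a2; lra.
Qed.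

Lemma convex_bounded (F : X -> R) (rho : R) : convex_on_space F ->
  exists2 M, 0 < M & forall x, `|x| <= rho -> `|F x| <= M.
Proof.
move=> cF; have [M hM] := convex_bounded_above rho cF.
move: cF => /convex_on_spaceP cF.
exists (2 * `|F 0| + `|M| + 1) => [|x xr].
  by rewrite ltr_wpDl// addr_ge0// mulr_ge0.
have h1 := hM x xr.
have h2 : F (- x) <= M by apply: hM; rewrite normrN.
have h3 : (0 : R) <= 2^-1 by lra.
have h4 : (2^-1 : R) <= 1 by lra.
(* The lower bound comes from the upper one, since [0] is the midpoint of [x] and [- x]. *)
have := cF _ x (- x) h3 h4.
have -> : 1 - 2^-1 = 2^-1 :> R by lra.
rewrite scalerN subrr => h5.
have := ler_norm M; have := ler_norm (- F 0); rewrite normrN.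
by rewrite ler_norml => h6 h7; apply/andP; split; have := normr_ge0 (F 0); lra.
Qed.

(* [x] lies between [z] and the point at distance [1] from [x] opposite to [z],
   where [F] is bounded. *)
Lemma convex_lower_lipschitz (F : X -> R) (rho : R) : convex_on_space F ->
  exists2 K, 0 < K & forall x z, `|x| <= rho -> F x - F z <= K * `|z - x|.
Proof.
move=> cF; have [M M0 hM] := convex_bounded (rho + 1) cF.
move: cF => /convex_on_spaceP cF.
exists (2 * M) => [|x z xr]; first by rewrite mulr_gt0.
have [->|zx] := eqVneq z x; first by rewrite !subrr normr0 mulr0.
set s := `|z - x|.
have s0 : 0 < s by rewrite normr_gt0 subr_eq0.
pose y := x - s^-1 *: (z - x).
have yr : `|y| <= rho + 1.
  rewrite (le_trans (ler_normB _ _))// lerD// normrZ normfV normr_id.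
  by rewrite mulVf// gt_eqF.
have xr1 : `|x| <= rho + 1 by rewrite (le_trans xr)// lerDl.
have s1 : 0 < 1 + s by rewrite addr_gt0.
pose t := (1 + s)^-1.
have t0 : 0 <= t by rewrite invr_ge0 ltW.
have t1 : t <= 1 by rewrite invf_le1// lerDl ltW.
have tE : t * (1 + s) = 1 by rewrite mulVf// gt_eqF.
have xE : t *: z + (1 - t) *: y = x.
  have -> : 1 - t = t * s by rewrite -[in LHS]tE; ring.
  have E : z + s *: y = (1 + s) *: x.
    rewrite /y scalerBr scalerA divff ?gt_eqF// scale1r scalerDl scale1r opprB.
    by rewrite addrCA [z + _]addrC subrK addrC.
  by rewrite -scalerA -scalerDr E scalerA tE scale1r.
have := cF _ z y t0 t1; rewrite xE => h1.
have h2 : (1 + s) * F x <= F z + s * F y.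
  rewrite -(ler_pM2l (_ : 0 < t)) ?invr_gt0// mulrA tE mul1r.
  suff <- : t * F z + (1 - t) * F y = t * (F z + s * F y) by [].
  by rewrite -[in 1 - t]tE; ring.
have := hM _ yr; have := hM _ xr1; rewrite !ler_norml => /andP[h3 _] /andP[_ h4].
nra.
Qed.

Lemma convex_continuous (F : X -> R) : convex_on_space F -> continuous F.
Proof.
move=> cF x; have [K K0 hK] := convex_lower_lipschitz (`|x| + 1) cF.
apply/(@cvgrPdist_le _ R^o) => e e0.
near=> z.
have zx : `|z - x| <= Num.min 1 (e / K).
  rewrite distrC; near: z; apply: cvgr_dist_le => //.
  by rewrite lt_min ltr01 divr_gt0.
move: zx; rewrite le_min => /andP[zx1 zxe].
have zn : `|z| <= `|x| + 1 by rewrite -(subrK x z) (le_trans (ler_normD _ _))// addrC lerD2l.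
have h1 : F x - F z <= K * `|z - x| by apply: hK; rewrite lerDl.
have h2 := hK _ x zn; rewrite distrC in h2.
have h3 : K * `|z - x| <= e by rewrite mulrC -ler_pdivlMr.
by rewrite ler_norml; apply/andP; split; lra.
Unshelve. all: by end_near. Qed.

End FiniteDimension.

(** * Gradients *)

Section Gradients.
Context (R : realType) (X : normedModType R).

Lemma diffZ_real (F : X -> R) (x d : X) (t : R) : 'd F x (t *: d) = t * 'd F x d.
Proof. exact: linearZ. Qed.

(** If the derivative towards [z] exceeded [F z - F x], so would the difference quotient at some
    small [t] in (0,1], contradicting convexity on the segment. *)
Lemma convex_gradient (F : X -> R) (x z : X) : convex_on_space F ->
  differentiable F x -> F x + 'd F x (z - x) <= F z.
Proof.
move=> /convex_on_spaceP cF dF; rewrite -deriveE//.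
have := @diff_derivable _ _ _ F x (z - x) dF; rewrite /derivable -/(derive F x (z - x)).
rewrite leNgt => cv; apply/negP => lt.
have /cvgr_gt /(_ (F z - F x)) : (fun h : R => h^-1 *: ((F \o shift x) (h *: (z - x)) - F x)) @ 0^' -->
   ('D_(z - x) F x : R^o) by exact: cv.
have -> : F z - F x < 'D_(z - x) F x by rewrite ltrBlDl.
move=> /(_ isT) /= [e e0 he].
pose t := Num.min 1 (e / 2).
have t0 : 0 < t by rewrite lt_min ltr01 divr_gt0.
have t1 : t <= 1 by rewrite ge_min lexx.
have te : t < e by rewrite gt_min; apply/orP; right; rewrite ltr_pdivrMr// ltr_pMr// ltr1n.
have := he t; rewrite /ball/= sub0r normrN gtr0_norm// => /(_ te).
rewrite gt_eqF// => /(_ isT).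
have -> : t *: (z - x) + x = t *: z + (1 - t) *: x.
  by rewrite scalerBr scalerBl scale1r addrAC addrA.
have := cF t z x (ltW t0) t1 => h1.
rewrite /GRing.scale/= => h2.
have : t * (F z - F x) < F (t *: z + (1 - t) *: x) - F x.
  by rewrite mulrC -ltr_pdivlMr// mulrC.
lra.
Qed.

(* Convexity at the endpoint [z] replaces the usual integration along the
   segment, at the cost of a factor [2]. *)
Lemma convex_descent (F : X -> R) (L : R) (x z : X) : convex_on_space F ->
  L_smooth L F -> F z <= F x + 'd F x (z - x) + L * `|z - x| ^+ 2.
Proof.
move=> cF [dF lF]; have := convex_gradient x cF (dF z).
have := lF z x (z - x).
have -> : x - z = - (z - x) by rewrite opprB.
rewrite linearN; have := ler_norm ('d F z (z - x) - 'd F x (z - x)); lra.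
Qed.

Lemma diff_bounded (Y : normedModType R) (F : X -> Y) (x : X) :
  differentiable F x -> exists2 K, 0 < K & forall d, `|'d F x d| <= K * `|d|.
Proof.
by move=> dF; apply: linear_lipschitz; exact: diff_continuous.
Qed.

End Gradients.

(** * A mean value inequality for vector-valued maps *)

Section MeanValue.
Context (R : realType) (X Y : normedModType R) (ip : {dot Y for idfun}).
Context (hn : forall y : Y, `|y| ^+ 2 = ip y y).

Lemma ip_continuous w : continuous (ip w : Y -> R).
Proof.
move=> y; apply/(@cvgrPdist_le _ R^o) => e e0; near=> z.
rewrite -ipNr -ipDr (le_trans (ip_norm hn _ _))//.
have wp : 0 < `|w| + 1 by rewrite ltr_wpDl.
rewrite (@le_trans _ _ ((`|w| + 1) * `|y - z|))//.
  by rewrite ler_wpM2r// lerDl.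
rewrite mulrC -ler_pdivlMr//; near: z; apply: cvgr_dist_le => //.
by rewrite divr_gt0.
Unshelve. all: by end_near. Qed.

Lemma ip_is_derive (G : X -> Y) (w : Y) (x d : X) (t : R) :
  differentiable G (x + t *: d) ->
  is_derive t 1 (fun t : R => ip w (G (x + t *: d))) (ip w ('d G (x + t *: d) d)).
Proof.
move=> dG.
have cv : (fun h : R => h^-1 *: ((G \o shift (x + t *: d)) (h *: d) - G (x + t *: d)))
    @ 0^' --> 'd G (x + t *: d) d.
  by rewrite -deriveE//; exact: (@diff_derivable _ _ _ G _ d dG).
have cvi : (fun h : R => ip w (h^-1 *: ((G \o shift (x + t *: d)) (h *: d) - G (x + t *: d))))
    @ 0^' --> (ip w ('d G (x + t *: d) d) : R^o).
  by apply: continuous_cvg => //; exact: ip_continuous.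
have E : (fun h : R => h^-1 *: (((fun t : R => ip w (G (x + t *: d)) : R^o) \o shift t) (h *: (1 : R^o)) -
    ip w (G (x + t *: d)))) =
   (fun h : R => ip w (h^-1 *: ((G \o shift (x + t *: d)) (h *: d) - G (x + t *: d)))).
  apply/funext => h /=.
  rewrite ipZr ipDr ipNr [h *: 1]mulr1 scalerDl.
  by rewrite [x + (_ + _)]addrCA.
split; first by rewrite /derivable E; apply/cvg_ex; eexists; exact: cvi.
by rewrite /derive E; apply/cvg_lim.
Qed.

(** The scalar mean value theorem is applied to [t |-> ip w (G (x + t *: d))] with [w] the increment
    [G z - G x] itself, so that the scalar increment is the square of its norm. *)
Lemma L_smooth_lipschitz (G : X -> Y) (L K : R) (x z : X) : L_smooth L G ->
  0 <= L -> 0 <= K -> (forall d, `|'d G x d| <= K * `|d|) ->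
  `|G z - G x| <= (K + L * `|z - x|) * `|z - x|.
Proof.
move=> [dG lG] L0 K0 hK.
set w := G z - G x; set d := z - x.
pose phi t : R := ip w (G (x + t *: d)).
have dphi (t : R) : is_derive t 1 phi (ip w ('d G (x + t *: d) d)) by exact: ip_is_derive.
have cphi : {within `[0, 1], continuous phi}.
  apply: continuous_subspaceT => t; apply: differentiable_continuous.
  by apply/derivable1_diffP; case: (dphi t).
have [c c01] := MVT_segment ler01 (fun t _ => dphi t) cphi.
rewrite /phi scale0r addr0 scale1r (_ : x + d = z); last by rewrite /d addrC subrK.
rewrite -ipNr -ipDr -/w -(hn w) subr0 mulr1 => wE.
have [->|w0] := eqVneq w 0.
  by rewrite normr0 mulr_ge0// addr_ge0// mulr_ge0.
have wp : 0 < `|w| by rewrite normr_gt0.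
rewrite -(ler_pM2l wp) -expr2 wE (le_trans (ler_norm _))//.
rewrite (le_trans (ip_norm hn _ _))// ler_wpM2l//.
move: c01; rewrite in_itv/= => /andP[c0 c1].
have := lG (x + c *: d) x d; rewrite addrAC subrr add0r normrZ ger0_norm// => h1.
have := hK d => h2.
have h3 : `|'d G (x + c *: d) d| <= `|'d G x d| + L * (c * `|d|) * `|d|.
  by rewrite -lerBlDl (le_trans (lerB_dist _ _)).
apply: (le_trans h3); rewrite mulrDl lerD//.
rewrite ler_wpM2r// ler_wpM2l// -[leRHS]mul1r ler_wpM2r//.
Qed.

End MeanValue.

(** * Cones, support functions and smoothing *)

Section Cones.
Context (R : realType) (Y : normedModType R) (ip : {dot Y for idfun}).
Context (hY : fin_dim_hilbert ip).
Context (K : set Y) (Kcl : closed K) (Kcvx : @convex_set R Y K) (Kcone : is_cone K).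

Let hn : forall y : Y, `|y| ^+ 2 = ip y y. Proof. by case: hY. Qed.

Lemma cone_add (a b : Y) : K a -> K b -> K (a + b).
Proof.
move=> Ka Kb.
have -> : a + b = 2 *: (2^-1 *: a + (1 - 2^-1) *: b).
  have -> : 1 - 2^-1 = 2^-1 :> R by lra.
  by rewrite -scalerDr scalerA divff// scale1r.
apply: Kcone => //; move/convex_setP: Kcvx; apply => //; lra.
Qed.

Lemma projection_exists (y : Y) : K 0 ->
  exists2 z, K z & forall w, K w -> `|y - z| <= `|y - w|.
Proof.
move=> K0; case: hY => _ [n [b sb]].
(* Points of norm above [2 * |y|] are farther from [y] than the origin is, so minimizing over this
   compact part suffices. *)
pose A := K `&` [set w | `|w| <= 2 * `|y|].
have An : A !=set0 by exists 0; split => //=; rewrite normr0 mulr_ge0.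
have cA : compact A.
  apply: (fin_dim_compact sb).
    exists (2 * `|y|); split; first by rewrite num_real.
    by move=> r hr w [_ /= hw]; rewrite (le_trans hw)// ltW.
  apply: closedI => //.
  by apply: (@closed_comp _ _ (fun w : Y => `|w|) [set r | r <= 2 * `|y|]);
    [move=> w _; exact: norm_continuous | exact: closed_le].
have cf : continuous (fun w => `|y - w|).
  move=> w; apply: (@cvg_norm _ _ _ (nbhs w) _ (fun w => y - w)).
  by apply: cvgB; [exact: cvg_cst | exact: cvg_id].
have [z zA zmin] := compact_EVT_min An cA (continuous_subspaceT cf).
rewrite inE in zA; case: zA => Kz _; exists z => // w Kw.
have [hw|hw] := leP `|w| (2 * `|y|); first by apply: zmin; rewrite inE.
have : `|y - z| <= `|y - 0| by apply: zmin; rewrite inE; split => //=; rewrite normr0 mulr_ge0.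
rewrite subr0 => /le_trans; apply.
have := ler_normB (w - y) (- y); rewrite opprK subrK distrC normrN; lra.
Qed.

Lemma projection_variational (y z : Y) : K z ->
  (forall w, K w -> `|y - z| <= `|y - w|) ->
  forall w, K w -> ip (y - z) (w - z) <= 0.
Proof.
move=> Kz zmin w Kw; rewrite leNgt; apply/negP => a0.
set a := ip _ _ in a0; set N := `|w - z| ^+ 2.
have N0 : 0 <= N by rewrite sqr_ge0.
(* Same device as in [strong_min]: moving a fraction [t] towards [w] changes the squared distance by
   [- 2 * t * a + t ^ 2 * N], negative for this [t]. *)
pose t := a / (a + N).
have aN : 0 < a + N by rewrite ltr_wpDr.
have t0 : 0 < t by rewrite divr_gt0.
have t1 : t <= 1 by rewrite ler_pdivrMr// mul1r lerDl.
have tE : t * (a + N) = a by rewrite divfK// gt_eqF.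
have Kt : K (t *: w + (1 - t) *: z).
  by move/convex_setP: Kcvx; apply => //; exact: ltW.
have := zmin _ Kt.
have -> : y - (t *: w + (1 - t) *: z) = (y - z) - t *: (w - z).
  by rewrite scalerBl scale1r addrCA -scalerBr opprD addrA.
rewrite -(ler_pXn2r (_ : 0 < 2)%N)// ?nnegrE//.
rewrite (normB2 hn (y - z)) normrZ exprMn real_normK ?num_real// ipZr -/a -/N.
have := mulr_gt0 t0 a0; have := mulr_gt0 t0 t0; nra.
Qed.

(** The residual [v] of the projection [z] of [y] is orthogonal to [z] and lies in the polar cone,
    so [|v| ^ 2 = ip v y <= 0] and [y = z]. *)
Lemma bipolar (y : Y) : K 0 -> (forall u, polar ip K u -> ip u y <= 0) -> K y.
Proof.
move=> K0 hy; have [z Kz zmin] := projection_exists y K0.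
have vz := projection_variational Kz zmin.
set v := y - z in vz.
(* The variational inequality is tested at [2 *: z] and at [0], giving both signs. *)
have vz0 : ip v z = 0.
  apply/eqP; rewrite eq_le; apply/andP; split.
    have := vz (2 *: z); rewrite scaler_nat mulr2n addrK; apply.
    by rewrite -mulr2n -scaler_nat; exact: Kcone.
  by have := vz 0 K0; rewrite sub0r ipNr; lra.
have : ip v y <= 0.
  by apply: hy => w /vz; rewrite ipDr ipNr vz0 subr0.
rewrite -(subrK z y) -/v ipDr vz0 addr0 -hn => h.
have : v = 0.
  by apply/eqP; rewrite -normr_eq0 -sqrf_eq0 eq_le h sqr_ge0.
by move=> ->; rewrite add0r.
Qed.

Context (Kn : K !=set0).
Context (B : set Y) (cB : compact B) (Bbase : is_base B (polar ip K)).

Lemma cone0 : K 0.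
Proof. by case: Kn => w Kw; rewrite -(scale0r w); exact: Kcone. Qed.

Lemma base_nonempty : B !=set0.
Proof.
case: Bbase => _ _ PE.
have : polar ip K 0 by move=> w _; rewrite ip0l.
by rewrite PE => -[t _ [u Bu _]]; exists u.
Qed.

Lemma base_polar u : B u -> polar ip K u.
Proof.
by case: Bbase => _ _ PE Bu; rewrite PE; exists 1 => //; exists u; rewrite ?scale1r.
Qed.

Let sigma := support_function ip B.

Lemma base_bounded : exists2 C, 0 < C & forall u, B u -> `|u| <= C.
Proof.
have [M [_ hM]] := compact_bounded cB.
exists (`|M| + 1); first by rewrite ltr_wpDl.
by move=> u Bu; apply: (hM (`|M| + 1)) => //; rewrite (le_lt_trans (ler_norm _))// ltrDl.
Qed.

Lemma ip_le_support y u : B u -> ip y u <= sigma y.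
Proof.
move=> Bu; apply: ub_le_sup; last by exists u.
have [C C0 hC] := base_bounded.
exists (`|y| * C) => _ [w Bw <-].
by rewrite (le_trans (ip_le_norm hn _ _))// ler_wpM2l// hC.
Qed.

Lemma support_le y M : (forall u, B u -> ip y u <= M) -> sigma y <= M.
Proof.
move=> h; apply: ge_sup; first by case: base_nonempty => u Bu; exists (ip y u); exists u.
by move=> _ [u Bu <-]; exact: h.
Qed.

(** This turns the conic constraint into a scalar inequality: nonnegative multiples of [B] exhaust
    the polar cone, and the bipolar theorem recovers [K]. *)
Lemma support_le0 y : K y <-> sigma y <= 0.
Proof.
split=> [Ky|sy]; first by apply: support_le => u /base_polar; rewrite ipC; exact.
apply: bipolar; first exact: cone0.
case: Bbase => _ _ ->  _ [t t0 [u Bu ->]].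
by rewrite ipZl mulr_ge0_le0// ipC (le_trans (ip_le_support _ Bu)).
Qed.

Lemma support_addK y w : K w -> sigma (y + w) <= sigma y.
Proof.
move=> Kw; apply: support_le => u Bu; rewrite ipDl.
have := ip_le_support y Bu; have := base_polar Bu Kw; rewrite (ipC _ u); lra.
Qed.

Lemma support_lipschitz : exists2 C, 0 < C &
  forall y w, sigma (y + w) <= sigma y + C * `|w|.
Proof.
have [C C0 hC] := base_bounded; exists C => // y w.
apply: support_le => u Bu; rewrite ipDl lerD// ?ip_le_support//.
by rewrite (le_trans (ip_le_norm hn _ _))// mulrC ler_wpM2r// hC.
Qed.

(** * Convex functions uniformly close to the support function *)

Section Smoothing.
Context (h : Y -> R) (c : R) (c0 : 0 < c).
Context (cvx : convex_on_space h).
Context (hl : forall y, sigma y <= h y) (hu : forall y, h y <= sigma y + c).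

(* A convex function bounded above along a ray is nonincreasing along it. *)
Lemma smoothing_monotone y w : K w -> h (y + w) <= h y.
Proof.
move=> Kw; rewrite leNgt; apply/negP => lt.
pose g := h (y + w) - h y.
have g0 : 0 < g by rewrite subr_gt0.
(* The point [y + w] is placed at fraction [s] of the way to [y + s^-1 *: w], where [h] exceeds
   [h y] by at most [c]. Convexity gives [g <= s * c], against [s * (g + c) = g]. *)
pose s := g / (g + c).
have gc : 0 < g + c by rewrite addr_gt0.
have s0 : 0 < s by rewrite divr_gt0.
have s1 : s <= 1 by rewrite ler_pdivrMr// mul1r lerDl ltW.
have sE : s * (g + c) = g by rewrite divfK// gt_eqF.
move/convex_on_spaceP: cvx => /(_ s (y + s^-1 *: w) y (ltW s0) s1).
have -> : s *: (y + s^-1 *: w) + (1 - s) *: y = y + w.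
  rewrite scalerDr scalerA divff ?gt_eqF// scale1r addrAC -scalerDl.
  by rewrite addrCA subrr addr0 scale1r.
have := hu (y + s^-1 *: w).
have : sigma (y + s^-1 *: w) <= sigma y.
  by apply: support_addK; apply: Kcone => //; rewrite invr_ge0 ltW.
have := hl y => h1 h2 h3 h4.
have : g <= s * c.
  have : s * h (y + s^-1 *: w) <= s * (h y + c) by rewrite ler_pM2l//; lra.
  rewrite /g; lra.
have := mulr_gt0 s0 g0; nra.
Qed.

(** The slope of [h] is limited by that of the support function, because a convex function steeper
    in some direction would leave the band of width [c] far along the ray. The bound does not
    involve [c], hence is uniform in the smoothing parameter. *)
Lemma smoothing_diff_bound (C : R) (y v : Y) :
  (forall y w, sigma (y + w) <= sigma y + C * `|w|) ->
  differentiable h y -> `|'d h y v| <= C * `|v|.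
Proof.
move=> hC dh.
suff H w : 'd h y w <= C * `|w|.
  by rewrite ler_norml H andbT lerNl -linearN (le_trans (H _))// normrN.
rewrite leNgt; apply/negP => lt.
pose g := 'd h y w - C * `|w|.
have g0 : 0 < g by rewrite subr_gt0.
(* Far enough for the accumulated excess [t * g = c + 1] to overtake the gap [c]. *)
pose t := (c + 1) / g.
have t0 : 0 < t by rewrite divr_gt0// addr_gt0.
have := @convex_gradient _ _ h y (y + t *: w) cvx dh.
rewrite [X in 'd _ _ X](_ : _ = t *: w); last by rewrite addrAC subrr add0r.
rewrite diffZ_real.
have := hu (y + t *: w); have := hC y (t *: w); have := hl y.
rewrite normrZ gtr0_norm// => h1 h2 h3 h4.
have tg : t * g = c + 1 by rewrite divfK// gt_eqF.
move: tg; rewrite /g mulrBr => tg; lra.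
Qed.

End Smoothing.
End Cones.

(** * Power sequences *)

Section PowerSequences.
Context (R : realType).
Implicit Types (x p q : R).

Lemma powRDp x p q : 0 < x -> x `^ (p + q) = x `^ p * x `^ q.
Proof. by move=> x0; rewrite powRD// (gt_eqF x0) implybT. Qed.

Lemma powR_ler x y p : 0 <= x -> x <= y -> 0 <= p -> x `^ p <= y `^ p.
Proof.
by move=> x0 xy p0; apply: ge0_ler_powR => //; rewrite nnegrE// (le_trans x0).
Qed.

Lemma powR_succ x p : 0 < x ->
  x `^ (- p) = (x + 1) `^ (- p) * (1 + x^-1) `^ p.
Proof.
move=> x0; have x1 : 0 < x + 1 by rewrite addr_gt0.
have -> : 1 + x^-1 = (x + 1) * x^-1 by rewrite mulrDl divff ?gt_eqF// mul1r.
rewrite powRM ?invr_ge0 ?ltW// mulrA -powRDp// addNr powRr0 mul1r.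
by rewrite -powR_inv1 ?ltW// -powRrM mulN1r.
Qed.

Lemma powR_succ_le x p : 0 < x -> p <= 1 ->
  x `^ (- p) <= (x + 1) `^ (- p) * (1 + x^-1).
Proof.
move=> x0 p1; rewrite powR_succ// ler_wpM2l ?powR_ge0//.
by apply: ler1_powR => //; rewrite lerDl invr_ge0 ltW.
Qed.

(** A discrete derivative of [x ^ (- q)]. One factor 2 comes from
    [(1 + x^-1) ^ q >= 1 + q * x^-1 / 2], the other from [x ^ (- q) <= 2 * (x + 1) ^ (- q)]. *)
Lemma powR_gap x q : 1 <= x -> 0 <= q -> q <= 1 ->
  q / 4 * x `^ (- (q + 1)) <= x `^ (- q) - (x + 1) `^ (- q).
Proof.
move=> x1 q0 q1; have x0 : 0 < x by exact: lt_le_trans x1.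
have u0 : 0 < x^-1 by rewrite invr_gt0.
have u1 : x^-1 <= 1 by rewrite invf_le1.
set P := (x + 1) `^ (- q); have P0 : 0 < P by rewrite powR_gt0// addr_gt0.
have h1 : 1 + q * (x^-1 / 2) <= (1 + x^-1) `^ q.
  rewrite /powR gt_eqF ?addr_gt0//; apply: le_trans (expR_ge1Dx _).
  rewrite lerD2l ler_wpM2l//.
  have v0 : 0 < 1 + x^-1 by rewrite addr_gt0.
  pose w := x^-1 / (1 + x^-1).
  have wE : w * (1 + x^-1) = x^-1 by rewrite divfK// gt_eqF.
  have w2 : x^-1 / 2 <= w by rewrite ler_pM2l// lef_pV2 ?posrE//; lra.
  (* The logarithmic bound is [u / (1 + u) <= ln (1 + u)], obtained from [ln (1 - w) <= - w] with
     [1 - w = (1 + u)^-1]. *)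
  apply: (le_trans w2).
  have w1 : w < 1 by rewrite ltr_pdivrMr// mul1r; lra.
  have : ln (1 + (- w)) <= - w by apply: le_ln1Dx; lra.
  have -> : 1 + - w = (1 + x^-1)^-1.
    by rewrite -[RHS]mul1r /w -{1}(divff (lt0r_neq0 v0)) -mulrBl addrK mul1r.
  by rewrite lnV ?posrE// lerN2.
have h2 : x `^ (- q) <= P * 2.
  apply: (le_trans (powR_succ_le x0 q1)); rewrite ler_wpM2l ?(ltW P0)//; lra.
have h3 : P * (1 + q * (x^-1 / 2)) <= x `^ (- q) by rewrite [leRHS]powR_succ// ler_pM2l.
have -> : x `^ (- (q + 1)) = x `^ (- q) * x^-1.
  by rewrite opprD powRDp// powR_inv1// ltW.
have : q * x^-1 * (x `^ (- q)) <= q * x^-1 * (P * 2).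
  by rewrite ler_wpM2l// mulr_ge0// ltW.
nra.
Qed.

(** Induction on [k]: if [e k] is still above the next target [E], the second alternative removes at
    least [E / x], which is as much as the target itself can drop in one step. *)
Lemma decay_rate (e : nat -> R) (c C r th p : R) (k0 : nat) :
  0 < c -> 0 <= C -> 0 < r -> r < 1 -> 2^-1 < th -> 0 < p -> p <= r ->
  p * (2 * th - 1) <= 1 - r ->
  (forall k, 0 <= e k) -> (forall k, e k.+1 <= e k) ->
  (forall k, (k0 <= k)%N -> e k <= C * (k.+1%:R `^ (- r)) \/
    e k.+1 <= e k - c * (k.+1%:R `^ (- r)) * (e k `^ (2 * th))) ->
  exists2 A, 0 < A & forall k, (k0 <= k)%N -> e k <= A * (k.+1%:R `^ (- p)).
Proof.
move=> c0 C0 r0 r1 th2 p0 pr pth e0 edec rec.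
have p1 : p <= 1 by lra.
have s0 : 0 < 2 * th - 1 by lra.
(* [A1] makes the decrement large enough, [A2] settles the start [k0], and [2 * C] in [A] absorbs
   the first alternative, with the 2 paying for the shift from [x] to [x + 1]. *)
pose A1 := (2 / c) `^ (2 * th - 1)^-1.
pose A2 := e k0 / (k0.+1%:R `^ (- p)).
have A10 : 0 < A1 by rewrite powR_gt0// divr_gt0.
have A20 : 0 <= A2 by rewrite divr_ge0// powR_ge0.
pose A := A1 + A2 + 2 * C.
have A0 : 0 < A by rewrite /A; lra.
have A1s : 2 / c <= A `^ (2 * th - 1).
  have -> : 2 / c = A1 `^ (2 * th - 1).
    by rewrite /A1 -powRrM mulVf ?gt_eqF// powRr1// divr_ge0// ltW.
  by apply: powR_ler; [exact: ltW|rewrite /A; lra|lra].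
exists A => // k; elim: k => [|k IH].
  rewrite leqn0 => /eqP k00.
  have : e k0 = A2 * (k0.+1%:R `^ (- p)) by rewrite divfK// gt_eqF// powR_gt0.
  rewrite k00 => ->; rewrite ler_wpM2r ?powR_ge0// /A; lra.
rewrite leq_eqVlt => /orP[/eqP <-|].
  have : e k0 = A2 * (k0.+1%:R `^ (- p)) by rewrite divfK// gt_eqF// powR_gt0.
  move=> ->; rewrite ler_wpM2r ?powR_ge0// /A; lra.
rewrite ltnS => k0k; have {}IH := IH k0k; have {}rec := rec k k0k.
set x : R := k.+1%:R in IH rec *.
have x1 : 1 <= x by rewrite ler1n.
have x0 : 0 < x by exact: lt_le_trans x1.
have -> : k.+2%:R = x + 1 :> R by rewrite /x -[in LHS]addn1 natrD.
clearbody x; set E := A * (x + 1) `^ (- p).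
have xx : 0 < x + 1 by rewrite addr_gt0.
have E0 : 0 < E by rewrite mulr_gt0// powR_gt0.
have hA : A * x `^ (- p) <= E * (1 + x^-1).
  by rewrite /E -mulrA ler_pM2l// powR_succ_le.
have u0 : 0 < x^-1 by rewrite invr_gt0.
have u1 : x^-1 <= 1 by rewrite invf_le1.
have [ekE|Eek] := leP (e k) E; first exact: le_trans (edec k) ekE.
have [h|h] := rec.
  apply: le_trans (edec k) (le_trans h _).
  have hp : x `^ (- r) <= x `^ (- p) by rewrite ler_powR// lerN2.
  have : C * x `^ (- r) <= C * x `^ (- p) by rewrite ler_wpM2l.
  have h2 : x `^ (- p) <= (x + 1) `^ (- p) * (1 + x^-1) by exact: powR_succ_le.
  have : C * x `^ (- p) <= C * ((x + 1) `^ (- p) * 2).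
    rewrite ler_wpM2l// (le_trans h2)// ler_wpM2l ?powR_ge0//; lra.
  have : 2 * C * (x + 1) `^ (- p) <= E.
    by rewrite /E ler_wpM2r ?powR_ge0// /A; lra.
  lra.
have hE : E `^ (2 * th) <= e k `^ (2 * th).
  by apply: powR_ler; [exact: ltW|exact: ltW|lra].
have hEE : E `^ (2 * th) = E * E `^ (2 * th - 1).
  by rewrite mulr_powRB1// ?ltW//; lra.
have hs : 2 / c * ((x + 1) `^ (- (1 - r))) <= E `^ (2 * th - 1).
  rewrite /E powRM ?powR_ge0 ?(ltW A0)// -powRrM ler_pM ?powR_ge0//.
    by rewrite divr_ge0// ltW.
  by rewrite mulNr ler_powR ?lerN2//; lra.
have hx : x `^ (- (1 - r)) <= (x + 1) `^ (- (1 - r)) * 2.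
  apply: le_trans (powR_succ_le x0 _) _; first by lra.
  by rewrite ler_wpM2l ?powR_ge0//; lra.
have hxr : x `^ (- r) * x `^ (- (1 - r)) = x^-1.
  by rewrite -powRDp// -opprD addrC subrK powR_inv1// ltW.
have xr0 : 0 < x `^ (- r) by rewrite powR_gt0.
have fin : E * x^-1 <= c * x `^ (- r) * e k `^ (2 * th).
  apply: le_trans (_ : c * x `^ (- r) * (E * (2 / c * ((x + 1) `^ (- (1 - r))))) <= _).
    rewrite -hxr.
    have -> : c * x `^ (- r) * (E * (2 / c * (x + 1) `^ (- (1 - r)))) =
       E * (x `^ (- r) * ((x + 1) `^ (- (1 - r)) * 2)).
      by field; rewrite gt_eqF.
    by rewrite ler_pM2l// ler_pM2l.
  rewrite ler_wpM2l//; first by rewrite mulr_ge0// ltW.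
  by apply: le_trans hE; rewrite hEE ler_pM2l.
by lra.
Qed.

(** Adding [T' * (j + 1) ^ (- (2 * r - 1)) + S * e j] to [a j] yields a nonincreasing sequence,
    since by [powR_gap] the added power drops by more than [T * mu j ^ 2]. [T'] is chosen before
    [a], as [a] will depend on a solution that varies with [k]. *)
Lemma fejer_tail (e mu : nat -> R) (c2 r S T : R) (k0 : nat) :
  2^-1 < r -> r < 1 -> 0 <= T -> 0 <= S -> (forall k, 0 <= e k) ->
  (forall k, 0 <= mu k) ->
  (forall k, (k0 <= k)%N -> mu k <= c2 * (k.+1%:R `^ (- r))) ->
  exists2 T', 0 <= T' & forall a : nat -> R,
    (forall k, a k.+1 <= a k + T * mu k ^+ 2 + S * (e k - e k.+1)) ->
    forall k m, (k0 <= k)%N -> (k <= m)%N ->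
    a m <= a k + T' * (k.+1%:R `^ (- (2 * r - 1))) + S * e k.
Proof.
move=> r2 r1 T0 S0 e0 mu0 hmu.
pose q := 2 * r - 1.
have q0 : 0 < q by rewrite /q; lra.
have q1 : q <= 1 by rewrite /q; lra.
pose T' := T * (c2 ^+ 2 * (4 / q)).
have T'0 : 0 <= T' by rewrite mulr_ge0// mulr_ge0 ?sqr_ge0// divr_ge0// ltW.
exists T' => // a ha k m k0k km.
pose b j := a j + T' * (j.+1%:R `^ (- q)) + S * e j.
have bdec j : (k0 <= j)%N -> b j.+1 <= b j.
  move=> k0j; rewrite /b; set x : R := j.+1%:R.
  have x1 : 1 <= x by rewrite ler1n.
  have x0 : 0 < x by exact: lt_le_trans x1.
  have -> : j.+2%:R = x + 1 :> R by rewrite /x -[in LHS]addn1 natrD.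
  have := powR_gap x1 (ltW q0) q1; have := ha j.
  have : mu j ^+ 2 <= c2 ^+ 2 * (x `^ (- (q + 1))).
    have -> : - (q + 1) = - r + - r by rewrite /q; lra.
    rewrite powRDp// -expr2 -exprMn ler_pXn2r// ?nnegrE// ?hmu//.
    exact: le_trans (mu0 j) (hmu j k0j).
  move=> h1 h2 h3.
  have h4 : T * mu j ^+ 2 <= T' * (q / 4 * (x `^ (- (q + 1)))).
    have -> : T' * (q / 4 * x `^ (- (q + 1))) = T * (c2 ^+ 2 * x `^ (- (q + 1))).
      by rewrite /T'; field; rewrite gt_eqF.
    by rewrite ler_wpM2l.
  have := ler_wpM2l T'0 h3; lra.
have bm : b m <= b k.
  elim: m km => [|m IH]; first by rewrite leqn0 => /eqP ->.
  rewrite leq_eqVlt => /orP[/eqP <-//|]; rewrite ltnS => km.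
  exact: le_trans (bdec m (leq_trans k0k km)) (IH km).
apply: le_trans bm; rewrite /b -addrA lerDl addr_ge0// mulr_ge0// powR_ge0.
Qed.
End PowerSequences.

(** * The rate from the three-point inequality *)

Section AbstractRate.
Context (R : realType) (X : normedModType R).

(** Compactness supplies a cluster point; the tail estimate passes to it along indices [m >= k] and
    then forces convergence of the whole sequence. *)
Lemma tail_bound_cvg (A : set X) (x : nat -> X) (C s : R) (k0 : nat) :
  compact A -> (forall k, A (x k)) -> 0 < C -> 0 < s ->
  (forall k m, (k0 <= k)%N -> (k <= m)%N ->
    `|x m - x k| <= C * (k.+1%:R `^ (- s))) ->
  exists xs, x k @[k --> \oo] --> xs /\
    forall k, (k0 <= k)%N -> `|x k - xs| <= C * (k.+1%:R `^ (- s)).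
Proof.
move=> cA Ax C0 s0 hx.
have xA : (x @ \oo) A by exists 0%N => // k _; exact: Ax.
have [xs [_ xs_cl]] := cA _ _ xA.
have bnd k : (k0 <= k)%N -> `|x k - xs| <= C * (k.+1%:R `^ (- s)).
  move=> k0k; apply/ler_addgt0Pr => e e0.
  have /(_ (x @` [set m | (k <= m)%N]) (ball xs e)) := xs_cl.
  case=> [||_ [[m /= km <-]] ].
  - by exists k => // m /= km; exists m.
  - exact: nbhsx_ballx.
  rewrite -ball_normE/= => mxs; rewrite -(subrK (x m) (x k)) -addrA.
  rewrite (le_trans (ler_normD _ _))// lerD//.
    by rewrite distrC; exact: hx.
  by rewrite distrC ltW.
exists xs; split => //; apply/cvgrPdist_le => e e0.
pose N : R := (C / e) `^ s^-1.
near=> k; rewrite distrC; apply: le_trans (bnd k _) _.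
  by near: k; exact: nbhs_infty_ge.
rewrite powRN ler_pdivrMr ?powR_gt0// mulrC -ler_pdivrMr//.
have -> : C / e = N `^ s by rewrite -powRrM mulVf ?gt_eqF// powRr1// divr_ge0// ltW.
apply: powR_ler; [exact: powR_ge0| |exact: ltW].
near: k; exists (Num.truncn N) => // k /= hk.
apply: (le_trans (ltW (truncnS_gt _))).
by rewrite ler_nat ltnS.
Unshelve. all: by end_near. Qed.

(** The algorithm reduced to inequalities: [phi] stands for the objective, [S] for the solution set,
    [phis] for the optimal value, [v] for the accepted multipliers, [M] for the Lagrangian
    curvatures and [delta] for the Slater margin at [x0]. *)
Context (phi : X -> R) (g : nat -> X -> R) (x : nat -> X) (x0 : X)
  (S : set X) (mu v M : nat -> R) (phis : R)
  (a3 delta D L Lmin Lbar c : R) (Emax : R) (mu0 : R).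
Hypotheses (a30 : 0 < a3) (delta0 : 0 < delta) (L0 : 0 < L)
  (Lmin0 : 0 < Lmin) (Lbar0 : 0 < Lbar) (c0 : 0 < c) (Emax0 : 0 < Emax).
Hypotheses (mu_gt0 : forall k, 0 < mu k) (mu_le : forall k, mu k <= mu0).
Hypotheses (v0 : forall k, 0 <= v k) (M_ge : forall k, Lmin <= M k)
  (M_gev : forall k, Lmin * v k <= M k * mu k)
  (M_le : forall k, M k * mu k <= Lbar * (mu k + v k)).
Hypothesis three_point : forall k z,
  phi (x k.+1) + M k / 2 * `|z - x k.+1| ^+ 2 <=
  phi z + v k * g k z + M k / 2 * `|z - x k| ^+ 2 + L * `|x k.+1 - x k| ^+ 2.
Hypothesis descent : forall k,
  c * (M k * `|x k.+1 - x k| ^+ 2) <= phi (x k) - phi (x k.+1).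
Hypotheses (phi_ge : forall k, phis <= phi (x k)) (phi_le : forall k, phi (x k) - phis <= Emax).
Hypotheses (g_x0 : forall k, g k x0 <= - delta) (x0E : phi x0 - phis <= Emax)
  (x0D : forall k, `|x0 - x k| <= D).
Hypotheses (S_phi : forall z, S z -> phi z = phis)
  (S_g : forall k z, S z -> g k z <= a3 * mu k).

Let e k := phi (x k) - phis.
Let d k := `|x k.+1 - x k|.

Let mu00 : 0 < mu0. Proof. exact: lt_le_trans (mu_gt0 0%N) (mu_le 0%N). Qed.
Let e0 k : 0 <= e k. Proof. by rewrite subr_ge0. Qed.
Let M0 k : 0 < M k. Proof. exact: lt_le_trans Lmin0 (M_ge k). Qed.

Let drop k : c * (M k * d k ^+ 2) <= e k - e k.+1.
Proof. by have := descent k; rewrite /e /d; lra. Qed.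

Let drop0 k : 0 <= e k - e k.+1.
Proof.
by apply: le_trans (drop k); rewrite mulr_ge0 ?(ltW c0)// mulr_ge0 ?sqr_ge0// ltW.
Qed.

Let step_sq k : c * Lmin * d k ^+ 2 <= e k - e k.+1.
Proof.
by apply: le_trans (drop k); rewrite -mulrA ler_pM2l// ler_wpM2r ?sqr_ge0// M_ge.
Qed.

Let sq_drop k z a : `|z - x k| <= a ->
  M k / 2 * `|z - x k| ^+ 2 - M k / 2 * `|z - x k.+1| ^+ 2 <= M k * (a * d k).
Proof.
move=> za; set p := `|z - x k| in za *; set q := `|z - x k.+1|.
have pq : p <= q + d k.
  by rewrite /p -(subrK (x k.+1) z) -addrA; exact: ler_normD.
have q0 : 0 <= q by exact: normr_ge0.
have d0 : 0 <= d k by exact: normr_ge0.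
have p0 : 0 <= p by exact: normr_ge0.
have : p ^+ 2 - q ^+ 2 <= 2 * (a * d k).
  have [qp|qp] := leP q p; last by nra.
  have : (p - q) * (p + q) <= d k * (2 * a) by apply: ler_pM; lra.
  lra.
have := M0 k; nra.
Qed.

(** At the Slater point the three-point inequality carries [- delta * v k] on its right side. The
    remaining terms are bounded, except for a cross term of which Young's inequality charges half of
    [delta * v k]. *)
Lemma multiplier_bounded : exists2 V, 0 < V &
  forall k, e k - e k.+1 <= mu k -> v k <= V.
Proof.
pose W := Emax + delta * mu0 / 2 + D ^+ 2 * Lbar / (2 * c * delta) +
  L * mu0 / (c * Lmin).
have W1 : 0 <= delta * mu0 / 2 by rewrite divr_ge0// mulr_ge0// ltW.
have W2 : 0 <= D ^+ 2 * Lbar / (2 * c * delta).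
  apply: divr_ge0; first by rewrite mulr_ge0 ?sqr_ge0// ltW.
  by rewrite !mulr_ge0// ltW.
have W3 : 0 <= L * mu0 / (c * Lmin) by rewrite divr_ge0// mulr_ge0// ltW.
have W0 : 0 < W by rewrite /W ltr_wpDr// ltr_wpDr// ltr_wpDr.
exists (2 * W / delta); first by rewrite divr_gt0// mulr_gt0.
move=> k hk; rewrite ler_pdivlMr//.
have h1 := three_point k x0; have h2 := sq_drop (x0D k).
have h3 : v k * g k x0 <= - (v k * delta) by rewrite -mulrN ler_wpM2l.
have h4 : L * d k ^+ 2 <= L * mu0 / (c * Lmin).
  rewrite -mulrA ler_pM2l// ler_pdivlMr ?mulr_gt0// mulrC.
  exact: le_trans (step_sq k) (le_trans hk (mu_le k)).
have h5 : M k * (D * d k) <= delta * (mu k + v k) / 2 + D ^+ 2 * Lbar / (2 * c * delta).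
  (* Young's parameter: it makes [eps * M k <= delta * (mu k + v k)], while [mu k / eps] stays
     constant, so the other half is bounded using the drop [<= mu k]. *)
  pose eps := delta * mu k / Lbar.
  have eps0 : 0 < eps by rewrite divr_gt0// mulr_gt0.
  have i1 : eps * M k <= delta * (mu k + v k).
    have -> : eps * M k = delta * ((M k * mu k) / Lbar) by rewrite /eps; ring.
    by rewrite ler_pM2l// ler_pdivrMr// [leRHS]mulrC.
  have i2 : M k * d k ^+ 2 / eps <= Lbar / (c * delta).
    have -> : Lbar / (c * delta) = (mu k / c) / eps.
      by rewrite /eps; field; rewrite !gt_eqF.
    rewrite ler_pM2r ?invr_gt0// ler_pdivlMr// mulrC.
    exact: le_trans (drop k) hk.
  have i3 : 2 * (D * d k) <= eps + D ^+ 2 * (d k ^+ 2 / eps).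
    have := sqr_ge0 (eps - D * d k) => i.
    rewrite -(ler_pM2l eps0) mulrDr.
    have -> : eps * (D ^+ 2 * (d k ^+ 2 / eps)) = D ^+ 2 * d k ^+ 2.
      by field; rewrite gt_eqF.
    nra.
  have i4 : D ^+ 2 * (M k * d k ^+ 2 / eps) <= D ^+ 2 * (Lbar / (c * delta)).
    by rewrite ler_wpM2l// sqr_ge0.
  have i5 := ler_wpM2l (ltW (M0 k)) i3.
  have -> : D ^+ 2 * Lbar / (2 * c * delta) = D ^+ 2 * (Lbar / (c * delta)) / 2.
    by field; rewrite !gt_eqF.
  have i6 : M k * (D ^+ 2 * (d k ^+ 2 / eps)) = D ^+ 2 * (M k * d k ^+ 2 / eps) by ring.
  lra.
have h6 : delta * mu k <= delta * mu0 by rewrite ler_pM2l.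
have h7 := phi_ge k.+1.
have h8 : 0 <= M k / 2 * `|x0 - x k.+1| ^+ 2 by rewrite mulr_ge0 ?sqr_ge0// divr_ge0// ltW.
rewrite -/(d k) in h1; rewrite /W.
have h9 := x0E; lra.
Qed.

Context (th kap : R) (th2 : 2^-1 < th) (th1 : th < 1) (kap0 : 0 < kap).
Hypothesis error_bound_S : forall k, exists2 z, S z &
  `|z - x k| <= kap * (e k `^ (1 - th)).

(** For a small drop, [e k] is at most a sum of three terms: a multiple of [mu k], a multiple of the
    drop, and the cross term [Q]. One of them is at least a third of [e k]; the first gives the left
    alternative, the others the right one. *)
Lemma rate_recursion : exists C K, [/\ 0 <= C, 0 < K & forall k,
  e k <= C * mu k \/ mu k * e k `^ (2 * th) <= K * (e k - e k.+1)].
Proof.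
have [V V0 hV] := multiplier_bounded.
pose Cm := Lbar * (mu0 + V).
have Cm0 : 0 < Cm by rewrite mulr_gt0// addr_gt0.
pose C2 := 1 + L / (c * Lmin).
have C20 : 0 < C2 by rewrite addr_gt0// divr_gt0// mulr_gt0.
pose W := Emax `^ (2 * th - 1).
have W0 : 0 < W by rewrite powR_gt0.
have s0 : 0 < 2 * th - 1 by have := th2; lra.
have powW k : e k `^ (2 * th) <= e k * W.
  rewrite -mulr_powRB1//; last by have := th2; lra.
  rewrite ler_wpM2l//; apply: powR_ler => //; first exact: phi_le.
  exact: ltW.
pose K1 := 3 * C2 * mu0 * W.
pose K2 := 9 * kap ^+ 2 * Cm / c.
pose K3 := Emax * W.
have K10 : 0 < K1.
  by apply: mulr_gt0 => //; apply: mulr_gt0 => //; apply: mulr_gt0.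
have K20 : 0 < K2.
  apply: divr_gt0 => //; apply: mulr_gt0 => //.
  by apply: mulr_gt0 => //; exact: exprn_gt0.
have K30 : 0 < K3 by apply: mulr_gt0.
pose K := K1 + K2 + K3.
have KD K' k : K' <= K -> mu k * e k `^ (2 * th) <= K' * (e k - e k.+1) ->
    mu k * e k `^ (2 * th) <= K * (e k - e k.+1).
  by move=> KK /le_trans; apply; rewrite ler_wpM2r.
exists (3 * V * a3), K; split; first by rewrite !mulr_ge0// ltW.
  by rewrite !addr_gt0.
move=> k.
have [hk|hk] := leP (e k - e k.+1) (mu k); last first.
  (* When the drop exceeds [mu k] the multiplier may be unbounded, but boundedness of [e k] alone
     suffices. *)
  right; apply: (@KD K3); first by rewrite /K; lra.
  have := powW k => h1.
  have h2 : mu k * e k `^ (2 * th) <= mu k * (Emax * W).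
    rewrite ler_pM2l//; apply: le_trans h1 _; rewrite ler_pM2r//; exact: phi_le.
  apply: (le_trans h2); rewrite mulrC /K3 ler_pM2l//; exact: ltW.
have vV := hV k hk.
have [z Sz zx] := error_bound_S k.
set rho := kap * e k `^ (1 - th) in zx.
have rho0 : 0 <= rho by rewrite mulr_ge0 ?powR_ge0// ltW.
pose Q := M k * (rho * d k).
have Q0 : 0 <= Q by apply: mulr_ge0; [exact: ltW|apply: mulr_ge0 => //; exact: normr_ge0].
have h1 := three_point k z; have h2 := sq_drop zx.
have h3 : v k * g k z <= V * (a3 * mu k).
  apply: (le_trans (ler_wpM2l (v0 k) (S_g k Sz))).
  by rewrite ler_pM2r// mulr_gt0.
have h4 : L * d k ^+ 2 <= L / (c * Lmin) * (e k - e k.+1).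
  rewrite -mulrA ler_pM2l// mulrC ler_pdivlMr ?mulr_gt0// mulrC; exact: step_sq.
rewrite (S_phi Sz) -/(d k) in h1.
have main : e k <= V * a3 * mu k + C2 * (e k - e k.+1) + Q.
  have -> : C2 * (e k - e k.+1) = (e k - e k.+1) + L / (c * Lmin) * (e k - e k.+1).
    by rewrite /C2; ring.
  have : e k.+1 = phi (x k.+1) - phis by [].
  rewrite -/Q in h2; lra.
have MC : M k * mu k <= Cm.
  apply: le_trans (M_le k) _; by rewrite /Cm ler_pM2l// lerD// mu_le.
(* One factor [M k] is paired with [mu k] and the other with the squared step, which descent
   controls. Cancelling [(e k ^ (1 - th)) ^ 2] from [e k ^ 2 <= 9 * Q ^ 2] then leaves the power
   [2 * th]. *)
have Qsq : mu k * Q ^+ 2 <= rho ^+ 2 * (Cm / c) * (e k - e k.+1).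
  have -> : mu k * Q ^+ 2 = rho ^+ 2 * ((M k * mu k) * (M k * d k ^+ 2)).
    by rewrite /Q; ring.
  rewrite -[leRHS]mulrA ler_wpM2l ?sqr_ge0//.
  have -> : Cm / c * (e k - e k.+1) = Cm * ((e k - e k.+1) / c) by ring.
  apply: ler_pM => //; first by apply: mulr_ge0; exact: ltW.
    by apply: mulr_ge0; [exact: ltW|exact: sqr_ge0].
  by rewrite ler_pdivlMr// mulrC.
have [i1|i1] := leP (e k) (3 * V * a3 * mu k); first by left.
right.
have [i2|i2] := leP (e k) (3 * (C2 * (e k - e k.+1))).
  apply: (@KD K1); first by rewrite /K; lra.
  apply: le_trans (_ : mu0 * (e k * W) <= _).
    by apply: ler_pM => //; [exact: ltW|exact: powR_ge0].
  have -> : K1 * (e k - e k.+1) = mu0 * (3 * (C2 * (e k - e k.+1)) * W) by rewrite /K1; ring.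
  by rewrite ler_pM2l// ler_pM2r.
apply: (@KD K2); first by rewrite /K; lra.
have eQ : e k <= 3 * Q by lra.
have [ek0|ek0] := eqVneq (e k) 0.
  rewrite ek0 powR0 ?mulr0; last by rewrite gt_eqF//; lra.
  by have := drop0 k; rewrite ek0 => ?; rewrite mulr_ge0// ltW.
have ek : 0 < e k by rewrite lt_neqAle eq_sym ek0 e0.
have E2 : e k ^+ 2 = e k `^ (2 * th) * (e k `^ (1 - th)) ^+ 2.
  rewrite -!powR_mulrn ?powR_ge0// ?(ltW ek)// -powRrM -powRDp//.
  by congr (_ `^ _); ring.
set w := (e k `^ (1 - th)) ^+ 2 in E2.
have w0 : 0 < w by rewrite exprn_gt0// powR_gt0.
rewrite -(ler_pM2r w0).
have -> : mu k * e k `^ (2 * th) * w = mu k * e k ^+ 2 by rewrite E2; ring.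
have -> : K2 * (e k - e k.+1) * w = 9 * (rho ^+ 2 * (Cm / c) * (e k - e k.+1)).
  by rewrite /K2 /rho /w; ring.
apply: le_trans (ler_wpM2l _ Qsq); last by [].
have -> : 9 * (mu k * Q ^+ 2) = mu k * (3 * Q) ^+ 2 by ring.
by rewrite ler_pM2l// ler_pXn2r// nnegrE// mulr_ge0.
Qed.

Context (r c1 c2 : R) (k0 : nat) (r2 : 2^-1 < r) (r1 : r < 1) (c10 : 0 < c1) (c20 : 0 < c2).
Hypothesis hmu : forall k, (k0 <= k)%N ->
  c1 * (k.+1%:R `^ (- r)) <= mu k /\ mu k <= c2 * (k.+1%:R `^ (- r)).

(** A solution [z] close to [x k] serves as anchor: the quasi-Fejer estimate keeps all later
    iterates near [z], and the triangle inequality compares them with [x k]. *)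
Lemma iterates_tail (s : R) : 0 < s -> s <= r - 2^-1 ->
  s * (2 * th - 1) <= (1 - r) * (1 - th) ->
  exists2 C, 0 < C & forall k m, (k0 <= k)%N -> (k <= m)%N ->
    `|x m - x k| <= C * (k.+1%:R `^ (- s)).
Proof.
move=> s0 sr sth.
have [C [K [C0 K0 rec]]] := rate_recursion.
have t0 : 0 < 1 - th by have := th1; lra.
(* The decay rate of [e k] for which the error bound yields distance of order [s]. *)
pose p := s / (1 - th).
have pt : p * (1 - th) = s by rewrite divfK// gt_eqF.
have p0 : 0 < p by rewrite divr_gt0.
have pth : p * (2 * th - 1) <= 1 - r.
  by rewrite -(ler_pM2r t0) mulrAC pt.
(* Indeed [p = p * (2 * th - 1) + 2 * (p * (1 - th)) <= (1 - r) + (2 * r - 1)]. *)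
have pr : p <= r by have := r1; nra.
have edec k : e k.+1 <= e k by have := drop0 k; lra.
have rec' k : (k0 <= k)%N -> e k <= C * c2 * (k.+1%:R `^ (- r)) \/
    e k.+1 <= e k - c1 / K * (k.+1%:R `^ (- r)) * (e k `^ (2 * th)).
  move=> /hmu[m1 m2]; have [h|h] := rec k; [left|right].
    by apply: (le_trans h); rewrite -mulrA ler_wpM2l.
  have : c1 / K * (k.+1%:R `^ (- r)) * (e k `^ (2 * th)) <= e k - e k.+1; last by lra.
  rewrite -(ler_pM2l K0); apply: le_trans h.
  have -> : K * (c1 / K * k.+1%:R `^ (- r) * e k `^ (2 * th)) =
      c1 * (k.+1%:R `^ (- r)) * e k `^ (2 * th) by field; rewrite gt_eqF.
  by rewrite ler_wpM2r// powR_ge0.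
have c1K : 0 < c1 / K by rewrite divr_gt0.
have Cc2 : 0 <= C * c2 by rewrite mulr_ge0// ltW.
have r0 : 0 < r by have := r2; lra.
have [A A0 hA] := decay_rate c1K Cc2 r0 r1 th2 p0 pr pth e0 edec rec'.
pose T := 2 * a3 / Lmin; pose Sg := 2 * L / (c * Lmin ^+ 2).
have T0 : 0 <= T by rewrite divr_ge0 ?mulr_ge0// ltW.
have Sg0 : 0 <= Sg by rewrite divr_ge0 ?mulr_ge0 ?exprn_ge0// ltW.
have fejer z : S z -> forall k, `|z - x k.+1| ^+ 2 <=
    `|z - x k| ^+ 2 + T * mu k ^+ 2 + Sg * (e k - e k.+1).
  move=> Sz k; have h1 := three_point k z; rewrite (S_phi Sz) -/(d k) in h1.
  have h2 := phi_ge k.+1.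
  have h3 : v k * g k z <= v k * (a3 * mu k) by rewrite ler_wpM2l// S_g.
  have h4 : v k * (a3 * mu k) <= M k / 2 * (T * mu k ^+ 2).
    have -> : M k / 2 * (T * mu k ^+ 2) = a3 * mu k * (M k * mu k / Lmin).
      by rewrite /T; field; rewrite gt_eqF.
    rewrite mulrC ler_pM2l ?mulr_gt0// ler_pdivlMr// mulrC; exact: M_gev.
  have h5 : L * d k ^+ 2 <= M k / 2 * (Sg * (e k - e k.+1)).
    apply: le_trans (_ : Lmin / 2 * (Sg * (e k - e k.+1)) <= _); last first.
      by rewrite ler_wpM2r ?ler_pM2r// mulr_ge0.
    have -> : Lmin / 2 * (Sg * (e k - e k.+1)) = L * ((e k - e k.+1) / (c * Lmin)).
      by rewrite /Sg; field; rewrite !gt_eqF.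
    rewrite ler_pM2l// ler_pdivlMr ?mulr_gt0// mulrC; exact: step_sq.
  have M2 : 0 < M k / 2 by rewrite divr_gt0.
  by rewrite -(ler_pM2l M2); lra.
have [T' T'0 tail] : exists2 T', 0 <= T' & forall z, S z -> forall k m,
    (k0 <= k)%N -> (k <= m)%N -> `|z - x m| ^+ 2 <=
    `|z - x k| ^+ 2 + T' * (k.+1%:R `^ (- (2 * r - 1))) + Sg * e k.
  have [T' T'0 tail] := fejer_tail r2 r1 T0 Sg0 e0 (fun k => ltW (mu_gt0 k))
    (fun k k0k => proj2 (hmu k0k)).
  by exists T' => // z Sz; apply: tail; exact: fejer.
pose kA := kap * A `^ (1 - th).
have kA0 : 0 < kA by rewrite mulr_gt0// powR_gt0.
pose H := kA ^+ 2 + T' + Sg * A.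
have H0 : 0 <= H by rewrite !addr_ge0 ?sqr_ge0// mulr_ge0// ltW.
exists (kA + Num.sqrt H); first by rewrite ltr_wpDr// sqrtr_ge0.
move=> k m k0k km; have [z Sz zx] := error_bound_S k.
have hAk := hA k k0k.
have := tail z Sz k m k0k km.
set y : R := k.+1%:R in hAk *.
have y1 : 1 <= y by rewrite ler1n.
have y0 : 0 < y by exact: lt_le_trans y1.
have zk : `|z - x k| <= kA * y `^ (- s).
  apply: (le_trans zx); rewrite /kA -mulrA ler_pM2l//.
  have -> : A `^ (1 - th) * y `^ (- s) = (A * y `^ (- p)) `^ (1 - th).
    by rewrite powRM ?powR_ge0 ?(ltW A0)// -powRrM mulNr pt.
  by apply: powR_ler; rewrite ?e0 ?(ltW t0).
set P := y `^ (- s) in zk *.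
have P0 : 0 < P by rewrite powR_gt0.
have PP : P ^+ 2 = y `^ (- (2 * s)).
  by rewrite /P -powR_mulrn ?powR_ge0// -powRrM; congr (_ `^ _); ring.
have yr : y `^ (- (2 * r - 1)) <= P ^+ 2 by rewrite PP ler_powR// lerN2; lra.
(* Here [th > 1/2] gives [2 * s = 2 * p * (1 - th) <= p]. *)
have yp : y `^ (- p) <= P ^+ 2.
  rewrite PP ler_powR// lerN2 -pt; have := th2; nra.
move=> h.
have zm : `|z - x m| <= Num.sqrt H * P.
  rewrite -(ler_pXn2r (_ : 0 < 2)%N)// ?nnegrE ?mulr_ge0 ?sqrtr_ge0 ?(ltW P0)//.
  rewrite exprMn sqr_sqrtr//; apply: (le_trans h).
  have j1 : `|z - x k| ^+ 2 <= kA ^+ 2 * P ^+ 2.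
    by rewrite -exprMn ler_pXn2r// nnegrE// mulr_ge0// ltW.
  have j2 := ler_wpM2l T'0 yr.
  have j3 : Sg * e k <= Sg * (A * P ^+ 2).
    by rewrite ler_wpM2l// (le_trans hAk)// ler_pM2l.
  rewrite /H; lra.
rewrite -(subrK z (x m)) -addrA (le_trans (ler_normD _ _))//.
rewrite distrC; lra.
Qed.

End AbstractRate.

(** * Solutions and error bound *)

Section Distance.
Context (R : realType) (X : normedModType R).

Lemma dist_le (x z : X) (A : set X) : A z -> dist x A <= `|x - z|.
Proof. by move=> Az; apply: ge_inf; [exists 0 => _ [w _ <-]|exists z]. Qed.

Lemma dist_adherent (x : X) (A : set X) (eps : R) : A !=set0 -> 0 < eps ->
  exists2 z, A z & `|x - z| < dist x A + eps.
Proof.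
move=> [z Az] eps0.
have hi : has_inf [set `|x - z| | z in A].
  by split; [exists `|x - z|; exists z|exists 0 => _ [w _ <-]].
by have [_ [w Aw <-] h] := inf_adherent eps0 hi; exists w.
Qed.

Lemma dist_triangle (x y : X) (A : set X) : A !=set0 ->
  dist x A <= `|x - y| + dist y A.
Proof.
move=> A0; apply/ler_addgt0Pr => eps eps0.
have [z Az h] := dist_adherent y A0 eps0.
apply: (le_trans (dist_le x Az)).
rewrite -(subrK y x) -addrA (le_trans (ler_normD _ _))// subrK -addrA lerD2l ltW//.
Qed.

End Distance.

(** * Existence of solutions and globalization of the error bound *)

Section Solutions.
Context (R : realType) (X Y : normedModType R) (p : problem X Y) (x0 : X).
Context (ipX : {dot X for idfun}) (hX : fin_dim_hilbert ipX).

Lemma psi_D : assumption_D p -> psi p = (fun x => pb_f p x + pb_P1 p x).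
Proof. by move=> [h _ _]; apply/funext => x; rewrite /psi h subr0. Qed.

Lemma solution_exists : continuous (psi p) -> continuous (pb_G p) ->
  closed (pb_K p) -> bounded_set (Omega0 p x0) -> feasible p x0 ->
  solution_set p !=set0.
Proof.
move=> cpsi cG cK bO fx0.
case: hX => _ [n [b sb]].
have cO : compact (Omega0 p x0).
  apply: (fin_dim_compact sb) => //.
  have -> : Omega0 p x0 = psi p @^-1` [set r | r <= psi p x0] `&` pb_G p @^-1` pb_K p by [].
  apply: closedI.
    by apply: closed_comp; [move=> x _; exact: cpsi|exact: closed_le].
  by apply: closed_comp => // x _; exact: cG.
have O0 : Omega0 p x0 !=set0 by exists x0.
have [z zO zmin] := compact_EVT_min O0 cO (continuous_subspaceT cpsi).
rewrite inE in zO; case: zO => zx0 zf; exists z; split => // w wf.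
have [h|h] := leP (psi p w) (psi p x0); first by apply: zmin; rewrite inE.
exact: le_trans zx0 (ltW h).
Qed.

Lemma optimal_valueE z : solution_set p z -> optimal_value p = psi p z.
Proof.
move=> [fz zmin]; apply/eqP; rewrite eq_le; apply/andP; split.
  by apply: ge_inf; [exists (psi p z) => _ [w fw <-]; exact: zmin|exists z].
apply: lb_le_inf; first by exists (psi p z); exists z.
by move=> _ [w fw <-]; exact: zmin.
Qed.

(* A point far from the solution set is pulled along a segment towards it until
   it enters the region where the local error bound holds. *)
Lemma global_error_bound (kappa theta eps0 eps1 D : R) :
  convex_on_space (psi p) -> @convex_set R X (feasible p) ->
  solution_set p !=set0 ->
  (forall x z, Omega0 p x0 x -> solution_set p z -> `|x - z| <= D) ->
  0 < D -> 0 < kappa -> theta < 1 -> 0 < eps0 -> 0 < eps1 ->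
  error_bound p x0 kappa theta eps0 eps1 ->
  exists2 kap, 0 < kap & forall x, Omega0 p x0 x ->
    exists2 z, solution_set p z &
      `|x - z| <= kap * ((psi p x - optimal_value p) `^ (1 - theta)).
Proof.
move=> /convex_on_spaceP cpsi /convex_setP cfeas S0 hD D0 k0 t1 e00 e10 EB.
have t0 : 0 < 1 - theta by rewrite subr_gt0.
set vs := optimal_value p.
have vsE z : solution_set p z -> psi p z = vs by move=> /optimal_valueE.
have vs_le x : feasible p x -> vs <= psi p x.
  by case: S0 => z Sz fx; rewrite -(vsE z Sz); case: Sz => _; exact.
(* The summands serve, in order, points in the local region, points with value gap above [eps1], and
   points farther than [eps0] from the solutions. *)
pose k1 := kappa + D / eps1 `^ (1 - theta) + D * kappa * (4 / (3 * eps0)).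
have e1p : 0 < eps1 `^ (1 - theta) by rewrite powR_gt0.
have k1a : 0 < D / eps1 `^ (1 - theta) by rewrite divr_gt0.
have k1b : 0 < D * kappa * (4 / (3 * eps0)).
  by apply: mulr_gt0; [exact: mulr_gt0|apply: divr_gt0 => //; exact: mulr_gt0].
have k10 : 0 < k1 by apply: addr_gt0 => //; exact: addr_gt0.
have distD x : Omega0 p x0 x -> dist x (solution_set p) <= D.
  by move=> Ox; case: S0 => z Sz; apply: (le_trans (dist_le x Sz)); exact: hD.
have key x : Omega0 p x0 x ->
    dist x (solution_set p) <= k1 * ((psi p x - vs) `^ (1 - theta)).
  move=> Ox; have fx : feasible p x by case: Ox.
  set e := psi p x - vs.
  have ee0 : 0 <= e by rewrite subr_ge0 vs_le.
  set E := e `^ (1 - theta); have E0 : 0 <= E by rewrite powR_ge0.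
  have [hd|hd] := leP (dist x (solution_set p)) eps0; last first.
    (* With a solution [z] optimal up to [eps0 / 4] and [y] at distance [eps0] from [z] on the
       segment to [x], the triangle inequality leaves [dist y] above [3 / 4 * eps0]; the error bound
       at [y] then bounds [E] below. *)
    have q0 : 0 < eps0 / 4 by rewrite divr_gt0.
    have [z Sz hz] := dist_adherent x S0 q0.
    set n := `|x - z| in hz.
    have hn : dist x (solution_set p) <= n by exact: dist_le.
    have n0 : 0 < n by lra.
    pose t := eps0 / n.
    have t0' : 0 < t by rewrite divr_gt0.
    have t1' : t <= 1 by rewrite ler_pdivrMr// mul1r; lra.
    have tn : t * n = eps0 by rewrite divfK// gt_eqF.
    pose y := t *: x + (1 - t) *: z.
    have fz : feasible p z by case: Sz.
    have fy : feasible p y by apply: cfeas => //; exact: ltW.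
    have psiy : psi p y - vs <= t * e.
      by have := cpsi t x z (ltW t0') t1'; rewrite (vsE z Sz) /e -/y; lra.
    have psiy2 : psi p y - vs <= e by nra.
    have Oy : Omega0 p x0 y.
      by split => //; case: Ox => + _; move: psiy2; rewrite /e; lra.
    have yz : y - z = t *: (x - z).
      by rewrite /y scalerBl scale1r scalerBr addrA addrAC addrK.
    have xy : x - y = (1 - t) *: (x - z).
      have -> : x - y = (x - z) - (y - z) by rewrite opprB addrA subrK.
      by rewrite yz scalerBl scale1r.
    have dy : dist y (solution_set p) <= eps0.
      by apply: (le_trans (dist_le y Sz)); rewrite yz normrZ gtr0_norm// -/n tn.
    have dxy := dist_triangle x y S0.
    rewrite xy normrZ ger0_norm ?subr_ge0// -/n mulrBl mul1r tn in dxy.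
    have [he|he] := leP e eps1; last first.
      apply: (le_trans (distD x Ox)).
      have : D / eps1 `^ (1 - theta) * eps1 `^ (1 - theta) <= D / eps1 `^ (1 - theta) * E.
        by rewrite ler_pM2l//; apply: powR_ler; exact: ltW.
      rewrite divfK ?gt_eqF// => h; apply: (le_trans h).
      by rewrite ler_wpM2r// /k1; lra.
    have hy := EB y Oy dy _.
    have {}hy : dist y (solution_set p) <= kappa * E.
      apply: le_trans (hy _) _; first by rewrite -/vs; lra.
      rewrite ler_pM2l//; apply: powR_ler => //; last exact: ltW.
      by rewrite subr_ge0 vs_le.
    apply: (le_trans (distD x Ox)).
    have h34 : 3 * eps0 <= 4 * (kappa * E) by lra.
    apply: le_trans (_ : D * kappa * (4 / (3 * eps0)) * E <= _); last first.
      by rewrite ler_wpM2r// /k1; lra.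
    have -> : D * kappa * (4 / (3 * eps0)) * E = D * ((4 * (kappa * E)) / (3 * eps0)).
      by field; rewrite gt_eqF.
    by rewrite -[leLHS]mulr1 ler_pM2l// ler_pdivlMr ?mul1r// mulr_gt0.
  have [he|he] := leP e eps1; last first.
    apply: (le_trans (distD x Ox)).
    have : D / eps1 `^ (1 - theta) * eps1 `^ (1 - theta) <= D / eps1 `^ (1 - theta) * E.
      by rewrite ler_pM2l//; apply: powR_ler; exact: ltW.
    rewrite divfK ?gt_eqF// => h; apply: (le_trans h).
    by rewrite ler_wpM2r// /k1; lra.
  apply: le_trans (EB x Ox hd _) _; first by rewrite -/vs -lerBlDl.
  by rewrite ler_wpM2r// /k1; lra.
(* The factor 2 pays for a near-minimizer of the distance. With a zero gap there is no slack, but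
   then [x] itself is a solution. *)
exists (2 * k1); first by rewrite mulr_gt0.
move=> x Ox; have fx : feasible p x by case: Ox.
set e := psi p x - vs.
have [ee|ee] := eqVneq e 0.
  exists x; last by rewrite subrr normr0 mulr_ge0 ?powR_ge0// ltW// mulr_gt0.
  split => // z fz; have := vs_le z fz; move/eqP: ee; rewrite subr_eq0 => /eqP ->.
  by [].
have e0 : 0 < e by rewrite lt_neqAle eq_sym ee subr_ge0 vs_le.
have E0 : 0 < k1 * e `^ (1 - theta) by rewrite mulr_gt0// powR_gt0.
have [z Sz hz] := dist_adherent x S0 E0.
exists z => //; have := key x Ox; rewrite -/e; lra.
Qed.

End Solutions.

(** * The convex problem *)

(** [j - i] counts the increments of [j] alone, all made while [j < J1]. As [i <= j], a joint
    increment happens only while [i] is below [I0] or [J0]. *)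
Lemma visited_bounds (accept infeas : nat -> nat -> Prop) (I0 J0 J1 : nat) :
  (forall i j, visited accept infeas i j -> ~ accept i j -> infeas i j ->
    (j < J1)%N) ->
  (forall i j, visited accept infeas i j -> ~ accept i j -> ~ infeas i j ->
    (i < I0)%N \/ (j < J0)%N) ->
  forall i j, visited accept infeas i j ->
    [/\ (i <= j)%N, (j <= J1 + i)%N & (i <= maxn I0 J0)%N].
Proof.
move=> h1 h2 i j; elim=> [//|{}i {}j v [ij jJ iI] na inf|{}i {}j v [ij jJ iI] na ninf].
- by split => //; [exact: leqW|rewrite (leq_trans (h1 i j v na inf))// leq_addr].
- split => //; first by rewrite addnS ltnS.
  have [iI0|jJ0] := h2 i j v na ninf; first by rewrite leq_max iI0.
  by rewrite leq_max (leq_ltn_trans ij jJ0) orbT.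
Qed.

Lemma exists_pow2_ge (R : realType) (a b : R) : 0 < a ->
  exists n : nat, forall m, (n <= m)%N -> b <= 2 ^+ m * a.
Proof.
move=> a0; exists (Num.truncn (b / a)).+1 => m nm.
rewrite -ler_pdivrMr//; apply: (le_trans (ltW (truncnS_gt _))).
have -> : 2 ^+ m = (2 ^ m)%:R :> R by rewrite natrX.
by rewrite ler_nat (leq_trans nm)// ltnW// ltn_expl.
Qed.

Lemma diff_affine (R : realType) (X : normedModType R) (F : X -> R) (x y z : X) (t : R) :
  'd F x (t *: y + (1 - t) *: z - x) =
  t * 'd F x (y - x) + (1 - t) * 'd F x (z - x).
Proof.
rewrite -!diffZ_real -linearD; congr ('d F x _).
by rewrite !scalerBr addrACA -opprD -scalerDl [t + _]addrC subrK scale1r.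
Qed.

Section ConvexProblem.
Context (R : realType) (X Y : normedModType R) (ipX : {dot X for idfun})
  (ipY : {dot Y for idfun}) (hX : fin_dim_hilbert ipX) (hY : fin_dim_hilbert ipY)
  (p : problem X Y) (x0 : X) (Lf LG : R) (hA : assumption_A p x0 Lf LG)
  (B : set Y) (Bc : compact B) (Bb : is_base B (polar ipY (pb_K p)))
  (h : R -> Y -> R) (a1 a2 a3 a4 : R) (hB : assumption_B ipY B h a1 a2 a3 a4)
  (hD : assumption_D p).

Local Notation g := (g_smoothed p h).

Lemma K_nonempty : pb_K p !=set0.
Proof. by case: (A_solid hA) => w /interior_subset; exists w. Qed.

Lemma psi_convex : convex_on_space (psi p).
Proof. by rewrite (psi_D hD); apply: convex_onD; [exact: D_f hD|exact: A_P1 hA]. Qed.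

Lemma G_convex_combination (x z : X) (t : R) : 0 <= t -> t <= 1 ->
  exists2 w, pb_K p w & pb_G p (t *: x + (1 - t) *: z) =
    t *: pb_G p x + (1 - t) *: pb_G p z + w.
Proof.
by move=> t0 t1; have [w Kw E] := D_G hD x z t0 t1; exists w => //; rewrite E subrK.
Qed.

Lemma feasible_convex : @convex_set R X (feasible p).
Proof.
apply/convex_setP => t x y t0 t1 fx fy; rewrite /feasible/=.
have [w Kw ->] := G_convex_combination x y t0 t1.
have cK := A_convex hA; apply: (cone_add cK (A_cone hA)) => //.
by move/convex_setP: cK; apply.
Qed.

Lemma feasible_of_g_le0 (mu : R) (x : X) : 0 < mu -> g mu x <= 0 -> feasible p x.
Proof.
move=> mu0 gx; apply/(support_le0 hY (A_closed hA) (A_convex hA) (A_cone hA) K_nonempty Bc Bb).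
exact: le_trans (B_lower hB _ mu0) gx.
Qed.

Lemma g_le_feasible (mu : R) (x : X) : 0 < mu -> feasible p x -> g mu x <= a3 * mu.
Proof.
move=> mu0 fx; apply: (le_trans (B_upper hB _ mu0)).
rewrite gerDr.
by apply/(support_le0 hY (A_closed hA) (A_convex hA) (A_cone hA) K_nonempty Bc Bb).
Qed.

(** [G] at a convex combination exceeds the combination of values by an element of [K], along which
    the smoothed function does not increase. *)
Lemma g_convex (mu : R) : 0 < mu -> convex_on_space (g mu).
Proof.
move=> mu0; apply/convex_on_spaceP => t x y t0 t1; rewrite /g_smoothed.
have [w Kw ->] := G_convex_combination x y t0 t1.
have a3mu : 0 < a3 * mu by rewrite mulr_gt0// (B_alpha3 hB).
apply: (@le_trans _ _ (h mu (t *: pb_G p x + (1 - t) *: pb_G p y))).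
  apply: (smoothing_monotone hY (A_cone hA) Bc Bb a3mu (B_convex hB mu0) _ _ _ Kw).
    by move=> u; exact: (B_lower hB u mu0).
  by move=> u; exact: (B_upper hB u mu0).
by move/convex_on_spaceP: (B_convex hB mu0); exact.
Qed.

Lemma G_diff x : differentiable (pb_G p) x.
Proof. by case: (A_G hA). Qed.

Lemma h_diff mu y : 0 < mu -> differentiable (h mu) y.
Proof. by move=> mu0; case: (B_smooth hB mu0). Qed.

Lemma g_diffE (mu : R) (x d : X) : 0 < mu ->
  'd (g mu) x d = 'd (h mu) (pb_G p x) ('d (pb_G p) x d).
Proof.
move=> mu0; have -> : g mu = h mu \o pb_G p by [].
by rewrite diff_comp//; [exact: G_diff|exact: (h_diff _ mu0)].
Qed.

Lemma g_differentiable (mu : R) (x : X) : 0 < mu -> differentiable (g mu) x.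
Proof.
move=> mu0; have -> : g mu = h mu \o pb_G p by [].
by apply: differentiable_comp; [exact: G_diff|exact: (h_diff _ mu0)].
Qed.

(** The gradient inequality of [g mu] at [y] is compared with the derivative at [x]: the change of
    the derivative of [h mu] costs order [1 / mu], that of [G] is weighted by the uniform bound
    [CB]. Terms free of [1 / mu] are absorbed through [mu <= m0]. *)
Lemma g_quadratic_bound (m0 K : R) : 0 < m0 -> 0 <= K ->
  exists2 C, 0 < C & forall (mu : R) (x y : X), 0 < mu -> mu <= m0 ->
    `|pb_G p y - pb_G p x| <= K * `|y - x| ->
    (forall d, `|'d (pb_G p) y d| <= K * `|d|) ->
    g mu y <= g mu x + 'd (g mu) x (y - x) + C / mu * `|y - x| ^+ 2.
Proof.
move=> m00 K0.
have [CB CB0 hCB] := support_lipschitz hY Bc Bb.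
have a10 := B_alpha1 hB; have a20 := B_alpha2 hB; have LG0 := A_LG hA.
pose C := (a1 * m0 + a2) * (K * K) + CB * LG * m0 + 1.
have C0 : 0 < C.
  rewrite /C ltr_wpDl// addr_ge0//.
    by rewrite mulr_ge0 ?mulr_ge0// addr_ge0 ?(ltW a20)// mulr_ge0// ltW.
  by rewrite !mulr_ge0// ltW.
exists C => // mu x y mu0 mum0 GK dK.
set d := y - x; set n := `|d|.
have n0 : 0 <= n by exact: normr_ge0.
have cg := convex_gradient x (g_convex mu0) (g_differentiable y mu0).
have E : x - y = - d by rewrite opprB.
rewrite E linearN in cg.
have [_ lh] := B_smooth hB mu0; have [_ lG] := A_G hA.
have b1 := lh (pb_G p y) (pb_G p x) ('d (pb_G p) y d).
have b2 : `|'d (h mu) (pb_G p x) ('d (pb_G p) y d - 'd (pb_G p) x d)| <= CB * (LG * n * n).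
  apply: le_trans (@smoothing_diff_bound _ _ ipY B _ (a3 * mu) _ _ _ _ CB _ _ hCB _) _.
  - by rewrite mulr_gt0// (B_alpha3 hB).
  - exact: (B_convex hB mu0).
  - by move=> u; exact: (B_lower hB u mu0).
  - by move=> u; exact: (B_upper hB u mu0).
  - exact: (h_diff _ mu0).
  by rewrite ler_pM2l//; exact: lG.
rewrite linearB in b2.
have amu : 0 <= a1 + a2 / mu by rewrite addr_ge0// divr_ge0// ltW.
have b3 : `|'d (h mu) (pb_G p y) ('d (pb_G p) y d) -
    'd (h mu) (pb_G p x) ('d (pb_G p) y d)| <= (a1 + a2 / mu) * (K * n) * (K * n).
  by apply: (le_trans b1); apply: ler_pM => //; [exact: mulr_ge0|exact: ler_wpM2l].
rewrite !g_diffE// in cg *.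
have i0 : 0 < mu^-1 by rewrite invr_gt0.
have i1 : mu * mu^-1 = 1 by rewrite divff// gt_eqF.
have b4 : a1 <= a1 * m0 / mu.
  by rewrite ler_pdivlMr// ler_wpM2l.
have b5 : CB * LG <= CB * LG * m0 / mu.
  by rewrite ler_pdivlMr// ler_wpM2l// mulr_ge0// ltW.
have n2 : 0 <= n ^+ 2 by exact: sqr_ge0.
have b6 : (a1 + a2 / mu) * (K * n) * (K * n) + CB * (LG * n * n) <= C / mu * n ^+ 2.
  have -> : C / mu * n ^+ 2 = ((a1 * m0 / mu + a2 / mu) * (K * K) + CB * LG * m0 / mu + mu^-1) * n ^+ 2.
    by rewrite /C; ring.
  have -> : (a1 + a2 / mu) * (K * n) * (K * n) + CB * (LG * n * n) =
     ((a1 + a2 / mu) * (K * K) + CB * LG) * n ^+ 2 by ring.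
  rewrite ler_wpM2r//.
  have : (a1 + a2 / mu) * (K * K) <= (a1 * m0 / mu + a2 / mu) * (K * K).
    by rewrite ler_wpM2r ?mulr_ge0// lerD2r.
  lra.
have c1 := le_trans (ler_norm _) b3; have c2 := le_trans (ler_norm _) b2.
lra.
Qed.

Lemma x0_feasible : feasible p x0.
Proof. exact: interior_subset (A_x0 hA). Qed.

Lemma Omega0_diameter : exists2 D, 0 < D & forall x z,
  Omega0 p x0 x -> Omega0 p x0 z -> `|x - z| <= D.
Proof.
have [M [_ hM]] := A_bounded hA.
have M1 : 0 < `|M| + 1 by rewrite ltr_wpDl.
have hM1 x : Omega0 p x0 x -> `|x| <= `|M| + 1.
  by apply: hM; rewrite (le_lt_trans (ler_norm _))// ltrDl.
exists (2 * (`|M| + 1)) => [|x z Ox Oz]; first by rewrite mulr_gt0.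
by rewrite (le_trans (ler_normB _ _))//; have := hM1 x Ox; have := hM1 z Oz; lra.
Qed.

Lemma solution_in_Omega0 z : solution_set p z -> Omega0 p x0 z.
Proof. by move=> [fz zmin]; split => //; apply: zmin; exact: x0_feasible. Qed.

Lemma psi_continuous : continuous (psi p).
Proof.
case: hX => _ [n [b sb]]; exact: (convex_continuous sb psi_convex).
Qed.

End ConvexProblem.

(** * Runs of the algorithm *)

(* Below [1/2] the exponent of the error bound is weakened to [1 / (2 r)], for
   which the two terms of the minimum coincide. *)
Lemma rate_exponent_choice (R : realType) (r theta : R) : 2^-1 < r -> r < 1 ->
  0 < theta -> theta < 1 -> exists th : R,
  [/\ theta <= th, 2^-1 < th, th < 1 & 0 < rate_exponent r theta /\
   rate_exponent r theta <= r - 2^-1 /\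
   rate_exponent r theta * (2 * th - 1) <= (1 - r) * (1 - th)].
Proof.
move=> r2 r1 t0 t1; rewrite /rate_exponent.
have r0 : 0 < r by lra.
have [t2|t2] := leP theta 2^-1.
  pose th := (2 * r)^-1.
  have E : th * (2 * r) = 1 by rewrite mulVf// gt_eqF// mulr_gt0.
  have th2 : 2^-1 < th by rewrite ltf_pV2 ?posrE ?mulr_gt0//; lra.
  have th1 : th < 1 by rewrite invf_lt1 ?mulr_gt0//; lra.
  exists th; split => //; first by lra.
  split; first by lra.
  by split => //; nra.
have s0 : 0 < 2 * theta - 1 by lra.
exists theta; split => //; split.
  rewrite lt_min; apply/andP; split; first by lra.
  by rewrite divr_gt0// mulr_gt0//; lra.
split; first by rewrite ge_min lexx.
by rewrite -ler_pdivlMr// ge_min lexx orbT.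
Qed.

Lemma model_sumE (R : realType) (P a n g0 dg L lam G m : R) : m != 0 ->
  P + a + L / 2 * n + lam * (g0 + dg + G / (2 * m) * n) =
  P + (a + lam * (g0 + dg)) + (L + lam * G / m) / 2 * n.
Proof. by move=> m0; field. Qed.

Section Run.
Context (R : realType) (X Y : normedModType R) (ipX : {dot X for idfun})
  (ipY : {dot Y for idfun}) (hX : fin_dim_hilbert ipX) (hY : fin_dim_hilbert ipY)
  (p : problem X Y) (x0 : X) (Lf LG : R) (hA : assumption_A p x0 Lf LG)
  (B : set Y) (Bc : compact B) (Bb : is_base B (polar ipY (pb_K p)))
  (h : R -> Y -> R) (a1 a2 a3 a4 : R) (hB : assumption_B ipY B h a1 a2 a3 a4)
  (tau1 tau2 Lmin Lmax : R) (htau1 : 0 < tau1) (htau2 : 0 < tau2)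
  (hLmin : 0 < Lmin) (s : iterates X)
  (hrun : sMBA_run ipX p h x0 tau1 tau2 Lmin Lmax s) (hD : assumption_D p).

Local Notation mu := (it_mu s).
Local Notation x := (it_x s).
Local Notation g k := (g_smoothed p h (it_mu s k)).
Local Notation vis := (trial_visited p h tau1 tau2 s).

Let hn : forall z : X, `|z| ^+ 2 = ipX z z. Proof. by case: hX. Qed.

Lemma mu_gt0 k : 0 < mu k.
Proof.
case: k => [|k]; first exact: run_mu0 hrun.
by have /andP[] := run_mu hrun k.
Qed.

Lemma mu_le0 k : mu k <= mu 0%N.
Proof.
elim: k => // k IH; apply: le_trans IH; have /andP[_ h1] := run_mu hrun k.
exact: ltW.
Qed.

Lemma g_succ_le k z : g k.+1 z <= g k z.
Proof.
have /andP[m1 m2] := run_mu hrun k.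
apply: (le_trans (B_mono hB (pb_G p z) m1 m2)); rewrite gerBl mulr_ge0//.
  exact: ltW (B_alpha4 hB).
by rewrite subr_ge0 ltW.
Qed.

Lemma g_le0 k z : g k z <= g 0%N z.
Proof. by elim: k => // k IH; exact: le_trans (g_succ_le k z) IH. Qed.

Lemma g_iterate_le0 k : g k (x k) <= 0.
Proof.
case: k => [|k]; first by rewrite (run_init hrun) ltW// (run_g0 hrun).
apply: (le_trans (g_succ_le k _)); rewrite (run_next hrun).
by case: (run_stop_accepted hrun k).
Qed.

Lemma xi_orthogonal k z : ipX (it_xi s k) z = 0.
Proof.
have H w : ipX (it_xi s k) w <= 0.
  have := run_xi hrun k (w + x k); rewrite !(D_P2 hD) add0r addrK; exact.
by apply/eqP; rewrite eq_le H -oppr_le0 -ipNr H.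
Qed.

Definition curvature k i j : R :=
  2 ^+ i * it_Lf0 s k + it_lam s k i j * (2 ^+ j * it_Lg0 s k) / mu k.

Lemma lam_ge0 k i j : vis k i j -> 0 <= it_lam s k i j.
Proof. by move=> v; case: (run_lam hrun v). Qed.

Lemma scaled_step_ge (i : nat) (L : R) : Lmin <= L -> Lmin <= 2 ^+ i * L.
Proof.
move=> hL; have L0 : 0 <= L by apply: le_trans hL; exact: ltW.
by apply: (le_trans hL); rewrite ler_peMl// exprn_ege1// ler1n.
Qed.

Lemma curvature_ge k i j : vis k i j -> Lmin <= curvature k i j.
Proof.
move=> v; have /andP[f1 _] := run_Lf0 hrun k; have /andP[g1 _] := run_Lg0 hrun k.
apply: (le_trans (scaled_step_ge i f1)); rewrite lerDl divr_ge0//.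
  rewrite mulr_ge0 ?lam_ge0//.
  exact: le_trans (ltW hLmin) (scaled_step_ge j g1).
exact: ltW (mu_gt0 k).
Qed.

(** Stated for all visited trials, not only accepted ones, because it also shows that backtracking
    ends. *)
Lemma trial_three_point k i j z : vis k i j ->
  psi p (it_trial s k i j) + curvature k i j / 2 * `|z - it_trial s k i j| ^+ 2 <=
  psi p z + it_lam s k i j * g k z + curvature k i j / 2 * `|z - x k| ^+ 2
  + Lf * `|it_trial s k i j - x k| ^+ 2.
Proof.
move=> v; set y := it_trial s k i j; have [lam0 comp sub] := run_lam hrun v.
set lam := it_lam s k i j in lam0 comp sub *.
set M := curvature k i j.
have m0 := mu_gt0 k.
pose F w := pb_P1 p w + ('d (pb_f p) (x k) (w - x k)
  + lam * (g k (x k) + 'd (g k) (x k) (w - x k))).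
have FE w : trial_objective ipX p s k i w + lam * trial_constraint p h s k j w =
    F w + M / 2 * `|w - x k| ^+ 2.
  rewrite /trial_objective /model_objective /trial_constraint /model_constraint.
  rewrite xi_orthogonal /F /M /curvature -/lam subr0.
  by apply: model_sumE; rewrite gt_eqF.
have cF : convex_on_space F.
  apply: convex_onD; first exact: A_P1 hA.
  apply/convex_on_spaceP => t w1 w2 t0 t1.
  rewrite !diff_affine le_eqVlt; apply/orP; left; apply/eqP.
  move: ('d (pb_f p) _ _) ('d (pb_f p) _ _) ('d (g k) _ _) ('d (g k) _ _) => u1 u2 u3 u4.
  by move: (g k _) => u5; ring.
have M0 : 0 <= M / 2.
  by rewrite divr_ge0// (le_trans (ltW hLmin))// curvature_ge.
have Fmin w : F y + M / 2 * `|y - x k| ^+ 2 <= F w + M / 2 * `|w - x k| ^+ 2.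
  by have := sub w; rewrite ip0l addr0 !FE.
have := strong_min hn cF M0 Fmin z.
have yE := FE y; rewrite comp addr0 in yE; rewrite -yE => H.
rewrite /trial_objective /model_objective xi_orthogonal subr0 in H.
have cf := D_f hD; have [df _] := A_f hA.
have h1 := convex_descent (x k) y cf (A_f hA).
have h2 := convex_gradient z cf (df (x k)).
have h3 := convex_gradient z (g_convex hY hA Bc Bb hB hD m0) (g_differentiable hA hB (x k) m0).
have h4 := ler_wpM2l lam0 h3.
have h5 : 0 <= 2 ^+ i * it_Lf0 s k / 2 * `|y - x k| ^+ 2.
  have /andP[f1 _] := run_Lf0 hrun k.
  by rewrite mulr_ge0 ?sqr_ge0// divr_ge0// (le_trans (ltW hLmin))// scaled_step_ge.
move: H h1 h2 h4 h5; rewrite !(psi_D hD) /F.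
move: (_ * `|z - y| ^+ 2) (_ * `|z - x k| ^+ 2) (_ * `|y - x k| ^+ 2) (_ * `|y - x k| ^+ 2).
move: ('d (pb_f p) _ _) ('d (pb_f p) _ _) ('d (g k) _ _) => d1 d2 d3 q1 q2 q3 q4.
move: (pb_f p y) (pb_f p z) (pb_f p (x k)) (pb_P1 p y) (pb_P1 p z) (g k z) (g k (x k)).
move=> f1 f2 f3 b1 b2 u1 u2 H h1 h2 h4 h5; lra.
Qed.

Lemma iterate_descent k :
  psi p (x k.+1) <= psi p (x k) - (tau1 * mu k +
    tau2 * it_lam s k (it_i s k) (it_j s k)) / (2 * mu k) * `|x k.+1 - x k| ^+ 2.
Proof. by rewrite (run_next hrun); case: (run_stop_accepted hrun k). Qed.

Lemma psi_succ_le k : psi p (x k.+1) <= psi p (x k).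
Proof.
apply: (le_trans (iterate_descent k)); rewrite gerBl mulr_ge0 ?sqr_ge0//.
have m0 := mu_gt0 k; have l0 := lam_ge0 (run_stop_visited hrun k).
apply: divr_ge0; last by rewrite mulr_ge0// ltW.
by apply: addr_ge0; apply: mulr_ge0 => //; exact: ltW.
Qed.

Lemma iterate_Omega0 k : Omega0 p x0 (x k).
Proof.
split; last first.
  exact: (feasible_of_g_le0 hY hA Bc Bb hB (mu_gt0 k) (g_iterate_le0 k)).
elim: k => [|k IH]; first by rewrite (run_init hrun).
exact: le_trans (psi_succ_le k) IH.
Qed.

(** [x k] is feasible for its own subproblem, so the trial does not increase the model; the
    quadratic term, at least [Lmin / 2 * |d| ^ 2], is then dominated by a linear one. *)
Lemma trial_bounded : exists2 rho, 0 < rho & forall k i j, vis k i j ->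
  `|it_trial s k i j - x k| <= rho.
Proof.
have [D D0 hDm] := Omega0_diameter hA.
have Ox0 : Omega0 p x0 x0 by split => //; exact: x0_feasible hA.
case: hX => _ [n [b sb]].
have [Kp Kp0 hKp] := convex_lower_lipschitz sb (`|x0| + D) (A_P1 hA).
have [df lf] := A_f hA.
have [Kf Kf0 hKf] := diff_bounded (df x0).
have Lf0 := A_Lf hA.
pose C := Kp + Kf + Lf * D.
have C0 : 0 < C by rewrite !addr_gt0// mulr_gt0.
exists (2 * C / Lmin); first by rewrite divr_gt0// mulr_gt0.
move=> k i j v; have [_ ymin] := run_trial hrun v.
set y := it_trial s k i j in ymin *.
have xxk : `|x k - x0| <= D by apply: hDm => //; exact: iterate_Omega0.
have xn : `|x k| <= `|x0| + D.
  by rewrite -(subrK x0 (x k)) (le_trans (ler_normD _ _))// addrC lerD2l.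
have fx : trial_constraint p h s k j (x k) <= 0.
  rewrite /trial_constraint /model_constraint subrr linear0 normr0 expr0n/= mulr0 !addr0.
  exact: g_iterate_le0.
have := ymin (x k) fx.
rewrite /trial_objective /model_objective !xi_orthogonal !subr0 subrr linear0.
rewrite normr0 expr0n/= mulr0 !addr0 => H.
have h1 := hKp (x k) y xn.
set d := y - x k in H h1 *.
have n0 : 0 <= `|d| by [].
have h2 : `|'d (pb_f p) (x k) d| <= (Kf + Lf * D) * `|d|.
  have e1 := lf (x k) x0 d; have e2 := hKf d.
  have e3 : Lf * `|x k - x0| * `|d| <= Lf * D * `|d|.
    by rewrite ler_wpM2r// ler_pM2l.
  have := lerB_dist ('d (pb_f p) (x k) d) ('d (pb_f p) x0 d).
  lra.
have h3 : - 'd (pb_f p) (x k) d <= `|'d (pb_f p) (x k) d| by rewrite -normrN ler_norm.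
have /andP[f1 _] := run_Lf0 hrun k.
have h4 : Lmin / 2 * `|d| ^+ 2 <= 2 ^+ i * it_Lf0 s k / 2 * `|d| ^+ 2.
  by rewrite ler_wpM2r ?sqr_ge0// ler_pM2r ?invr_gt0// scaled_step_ge.
have h5 : Lmin * `|d| ^+ 2 <= 2 * C * `|d| by rewrite /C; lra.
rewrite ler_pdivlMr//; have [->|d0] := eqVneq `|d| 0.
  by rewrite mul0r mulr_ge0// ltW.
have dp : 0 < `|d| by rewrite lt_neqAle eq_sym d0.
rewrite -(ler_pM2r dp); apply: le_trans h5.
by rewrite expr2 mulrA [`|d| * _]mulrC.
Qed.

Lemma backtracking_bounded : exists N : nat, forall k i j, vis k i j ->
  (i <= N)%N /\ (j <= N)%N.
Proof.
have [rho rho0 hrho] := trial_bounded.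
have [D D0 hDm] := Omega0_diameter hA.
have Ox0 : Omega0 p x0 x0 by split => //; exact: x0_feasible hA.
have LG0 := A_LG hA; have [dG lG] := A_G hA.
have [K0 K00 hK0] := diff_bounded (dG x0).
pose K := K0 + LG * (D + rho).
have Kge : 0 <= K by apply: addr_ge0; [exact: ltW|apply: mulr_ge0 => //; apply: addr_ge0; exact: ltW].
have [C C0 hC] := g_quadratic_bound hY hA Bc Bb hB hD (mu_gt0 0%N) Kge.
have [J1 hJ1] := exists_pow2_ge (2 * C) hLmin.
have [I0 hI0] := exists_pow2_ge (2 * Lf + tau1) hLmin.
have [J0 hJ0] := exists_pow2_ge tau2 hLmin.
exists (J1 + maxn I0 J0)%N => k i j v.
have [||ij jJ iI] := visited_bounds (J1 := J1) (I0 := I0) (J0 := J0) _ _ v; last first.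
  split; first exact: leq_trans iI (leq_addl _ _).
  by apply: (leq_trans jJ); rewrite leq_add2l.
(* A feasible trial is rejected only for insufficient decrease. For large [i] and [j] the
   three-point inequality at [z = x k] provides that decrease. *)
- move=> {v}i {}j v nacc ninf.
  have [|nI] := ltnP i I0; [by left|right].
  rewrite ltnNge; apply/negP => nJ; apply: nacc.
  have yf : g k (it_trial s k i j) <= 0 by rewrite leNgt; apply/negP.
  split => //; have := trial_three_point (x k) v.
  rewrite subrr normr0 expr0n/= mulr0 addr0 distrC.
  have lam0 := lam_ge0 v; have m0 := mu_gt0 k.
  set lam := it_lam s k i j in lam0 *.
  set q := `|_| ^+ 2; have q0 : 0 <= q by exact: sqr_ge0.
  have h1 : lam * g k (x k) <= 0 by rewrite mulr_ge0_le0// g_iterate_le0.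
  have /andP[f1 _] := run_Lf0 hrun k; have /andP[g1 _] := run_Lg0 hrun k.
  have h2 : 2 * Lf + tau1 <= 2 ^+ i * it_Lf0 s k.
    by apply: (le_trans (hI0 i nI)); rewrite ler_pM2l// exprn_gt0.
  have h3 : tau2 <= 2 ^+ j * it_Lg0 s k.
    by apply: (le_trans (hJ0 j nJ)); rewrite ler_pM2l// exprn_gt0.
  have h4 : 2 * Lf + (tau1 * mu k + tau2 * lam) / mu k <= curvature k i j.
    have -> : (tau1 * mu k + tau2 * lam) / mu k = tau1 + tau2 * lam / mu k.
      by rewrite mulrDl mulfK// gt_eqF.
    rewrite addrA /curvature -/lam lerD//.
    by rewrite ler_pM2r ?invr_gt0// mulrC ler_wpM2l.
  have h5 := ler_wpM2r q0 h4.
  have -> : (tau1 * mu k + tau2 * lam) / (2 * mu k) = (tau1 * mu k + tau2 * lam) / mu k / 2.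
    by field; rewrite gt_eqF.
  lra.
(* Once [2 ^ j * it_Lg0 s k >= 2 * C] the constraint model majorizes [g] at the trial, which is
   therefore feasible. *)
- move=> {v}i {}j v _ inf; rewrite ltnNge; apply/negP => nJ.
  have [yc _] := run_trial hrun v.
  set y := it_trial s k i j in yc.
  move: inf; rewrite /trial_infeasible -/y ltNge => /negP; apply.
  apply: le_trans yc; rewrite /trial_constraint /model_constraint.
  have m0 := mu_gt0 k.
  have yx : `|y - x k| <= rho by exact: hrho.
  have xx : `|x k - x0| <= D by apply: hDm => //; exact: iterate_Omega0.
  have dist_bd (w d : X) (e : R) : `|w - x0| <= e -> `|'d (pb_G p) w d| <= (K0 + LG * e) * `|d|.
    move=> we; have e1 := lG w x0 d; have e2 := hK0 d.
    have e3 : LG * `|w - x0| * `|d| <= LG * e * `|d|.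
      by rewrite ler_wpM2r// ler_wpM2l.
    have := lerB_dist ('d (pb_G p) w d) ('d (pb_G p) x0 d); lra.
  have dy d : `|'d (pb_G p) y d| <= K * `|d|.
    apply: dist_bd; rewrite -(subrK (x k) y) -addrA addrC.
    by rewrite (le_trans (ler_normD _ _))// lerD.
  have KD : 0 <= K0 + LG * D.
    by apply: addr_ge0; [exact: ltW|apply: mulr_ge0 => //; exact: ltW].
  have Gyx : `|pb_G p y - pb_G p (x k)| <= K * `|y - x k|.
    case: (hY) => hnY _.
    apply: le_trans (L_smooth_lipschitz hnY y (A_G hA) LG0 KD (fun d => dist_bd (x k) d D xx)) _.
    rewrite ler_wpM2r// -addrA lerD2l -mulrDr ler_wpM2l// lerD2l//.
  apply: (le_trans (hC (mu k) (x k) y m0 (mu_le0 k) Gyx dy)).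
  rewrite lerD2l ler_wpM2r ?sqr_ge0//.
  have /andP[g1 _] := run_Lg0 hrun k.
  have h3 : 2 * C <= 2 ^+ j * it_Lg0 s k.
    by apply: (le_trans (hJ1 j nJ)); rewrite ler_pM2l// exprn_gt0.
  rewrite invfM mulrA ler_pM2r ?invr_gt0// ler_pdivlMr// mulrC; exact: h3.
Qed.

End Run.

(** Bounded backtracking caps both curvature estimates by [2 ^ N * Lmax], so [M k * mu k] is at most
    a multiple of [mu k + v k], the quantity that the acceptance test measures. *)
Lemma step_constants (R : realType) (X Y : normedModType R)
    (ipX : {dot X for idfun}) (ipY : {dot Y for idfun})
    (hX : fin_dim_hilbert ipX) (hY : fin_dim_hilbert ipY)
    (p : problem X Y) (x0 : X) (Lf LG : R) (hA : assumption_A p x0 Lf LG)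
    (B : set Y) (Bc : compact B) (Bb : is_base B (polar ipY (pb_K p)))
    (h : R -> Y -> R) (a1 a2 a3 a4 : R) (hB : assumption_B ipY B h a1 a2 a3 a4)
    (tau1 tau2 Lmin Lmax : R) (htau1 : 0 < tau1) (htau2 : 0 < tau2)
    (hLmin : 0 < Lmin) (hLmax : Lmin <= Lmax) (s : iterates X)
    (hrun : sMBA_run ipX p h x0 tau1 tau2 Lmin Lmax s) (hD : assumption_D p) :
  let v k := it_lam s k (it_i s k) (it_j s k) in
  let M k := curvature s k (it_i s k) (it_j s k) in
  exists Lbar c, [/\ 0 < Lbar, 0 < c,
    forall k, M k * it_mu s k <= Lbar * (it_mu s k + v k),
    forall k, Lmin * v k <= M k * it_mu s k &
    forall k, c * (M k * `|it_x s k.+1 - it_x s k| ^+ 2) <=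
      psi p (it_x s k) - psi p (it_x s k.+1)].
Proof.
move=> v M.
have [N hN] := backtracking_bounded hX hY hA Bc Bb hB htau1 htau2 hLmin hrun hD.
have Lmax0 : 0 < Lmax by exact: lt_le_trans hLmin hLmax.
pose Lbar := 2 ^+ N * Lmax.
have Lbar0 : 0 < Lbar by rewrite mulr_gt0// exprn_gt0.
pose tm := Num.min tau1 tau2.
have tm0 : 0 < tm by rewrite lt_min htau1 htau2.
have v0 k : 0 <= v k by exact: (lam_ge0 hrun (run_stop_visited hrun k)).
have m0 k : 0 < it_mu s k by exact: (mu_gt0 hrun k).
have pow_le i L : (i <= N)%N -> Lmin <= L -> L <= Lmax -> 2 ^+ i * L <= Lbar.
  move=> iN L1 L2; apply: ler_pM => //; first exact: le_trans (ltW hLmin) L1.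
  by rewrite ler_eXn2l// ltr1n.
have ME k : M k * it_mu s k =
    2 ^+ it_i s k * it_Lf0 s k * it_mu s k + v k * (2 ^+ it_j s k * it_Lg0 s k).
  by rewrite /M /curvature mulrDl divfK// gt_eqF.
have M_le k : M k * it_mu s k <= Lbar * (it_mu s k + v k).
  have [iN jN] := hN k _ _ (run_stop_visited hrun k).
  have /andP[f1 f2] := run_Lf0 hrun k; have /andP[g1 g2] := run_Lg0 hrun k.
  rewrite ME mulrDr lerD//; first by rewrite ler_pM2r// pow_le.
  by rewrite mulrC ler_wpM2r// pow_le.
exists Lbar, (tm / (2 * Lbar)); split => //; first by rewrite divr_gt0// mulr_gt0.
  move=> k; have /andP[f1 _] := run_Lf0 hrun k; have /andP[g1 _] := run_Lg0 hrun k.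
  have q1 := scaled_step_ge hLmin (it_i s k) f1.
  have q2 := scaled_step_ge hLmin (it_j s k) g1.
  rewrite ME [leRHS]addrC ler_wpDr//.
    by rewrite mulr_ge0 ?(ltW (m0 k))// (le_trans (ltW hLmin)).
  by rewrite mulrC ler_wpM2l.
move=> k; have := iterate_descent hrun k; rewrite -/(v k).
set n := _ ^+ 2 => H; have n0 : 0 <= n by exact: sqr_ge0.
suff : tm / (2 * Lbar) * (M k * n) <=
    (tau1 * it_mu s k + tau2 * v k) / (2 * it_mu s k) * n by lra.
rewrite mulrA ler_wpM2r//.
rewrite ler_pdivlMr; last by rewrite mulr_gt0.
have -> : tm / (2 * Lbar) * M k * (2 * it_mu s k) = tm * (M k * it_mu s k / Lbar).
  by field; rewrite gt_eqF.
apply: (@le_trans _ _ (tm * (it_mu s k + v k))).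
  by rewrite ler_pM2l// ler_pdivrMr// [leRHS]mulrC.
rewrite mulrDr lerD//; first by rewrite ler_pM2r// ge_min lexx.
by rewrite ler_wpM2r// ge_min lexx orbT.
Qed.

(** * Convergence and rate of the iterates *)

Theorem theorem4p5 (R : realType) (X Y : normedModType R)
    (ipX : {dot X for idfun}) (ipY : {dot Y for idfun})
    (hX : fin_dim_hilbert ipX) (hY : fin_dim_hilbert ipY)
    (p : problem X Y) (x0 : X) (Lf LG : R)
    (hA : assumption_A p x0 Lf LG)
    (B : set Y) (hBcompact : compact B) (hBbase : is_base B (polar ipY (pb_K p)))
    (h : R -> Y -> R) (alpha1 alpha2 alpha3 alpha4 : R)
    (hB : assumption_B ipY B h alpha1 alpha2 alpha3 alpha4)
    (tau1 tau2 Lmin Lmax : R)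
    (htau1 : 0 < tau1) (htau2 : 0 < tau2)
    (hLmin : 0 < Lmin) (hLmax : Lmin <= Lmax)
    (s : iterates X)
    (hrun : sMBA_run ipX p h x0 tau1 tau2 Lmin Lmax s)
    (hC : assumption_C (it_mu s))
    (hD : assumption_D p)
    (r : R) (hE : assumption_E (it_mu s) r)
    (kappa theta eps0 eps1 : R)
    (hkappa : 0 < kappa) (htheta0 : 0 < theta) (htheta1 : theta < 1)
    (heps0 : 0 < eps0) (heps10 : 0 < eps1) (heps11 : eps1 < 1)
    (hEB : error_bound p x0 kappa theta eps0 eps1) :
  exists xstar : X,
    it_x s k @[k --> \oo] --> xstar /\
    exists (k1 : nat) (kappa1 : R),
      0 < kappa1 /\
      forall k : nat, (k1 <= k)%N ->
        `|it_x s k - xstar| <=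
          kappa1 * (k.+1%:R `^ (- rate_exponent r theta)).
Proof.
have psic := psi_convex hA hD.
have psicont := psi_continuous hX hA hD.
have Gc : continuous (pb_G p).
  by move=> x; apply: differentiable_continuous; exact: (G_diff hA).
have Snon := solution_exists hX psicont Gc (A_closed hA) (A_bounded hA) (x0_feasible hA).
have [D D0 hDm] := Omega0_diameter hA.
have SO := @solution_in_Omega0 _ _ _ _ _ _ _ hA.
have hDS x z : Omega0 p x0 x -> solution_set p z -> `|x - z| <= D.
  by move=> Ox /SO; exact: hDm.
have [kap kap0 hkap] := global_error_bound psic (feasible_convex hA hD) Snon hDS
  D0 hkappa htheta1 heps0 heps10 hEB.
have [Lbar [c [Lbar0 c0 M_le M_gev hdesc]]] := step_constants hX hY hA hBcompact
  hBbase hB htau1 htau2 hLmin hLmax hrun hD.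
have [r2 r1 [c1 [c2 [k0 [c10 c20 hmu]]]]] := hE.
have [th [tth th2 th1 [s0 [sr sth]]]] := rate_exponent_choice r2 r1 htheta0 htheta1.
have iO := iterate_Omega0 hY hA hBcompact hBbase hB htau1 htau2 hrun.
have Ox0 : Omega0 p x0 x0 by split => //; exact: (x0_feasible hA).
have [zs zsS] := Snon.
have optE z : solution_set p z -> psi p z = optimal_value p.
  by move=> /optimal_valueE.
have opt_le x : Omega0 p x0 x -> optimal_value p <= psi p x.
  by move=> [_ fx]; rewrite -(optE _ zsS); case: zsS => _; exact.
(* The added 1 keeps the bound positive even when [x0] is optimal. *)
pose E := psi p x0 - optimal_value p + 1.
have E0 : 0 < E by rewrite ltr_wpDl// subr_ge0; exact: opt_le.
have E1 x : Omega0 p x0 x -> psi p x - optimal_value p <= E.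
  by move=> [h1 _]; rewrite /E; lra.
(* Since the gaps are at most [E], raising the exponent [theta] to [th] costs only the factor
   [E ^ (th - theta)]. *)
have EB' k : exists2 z, solution_set p z & `|z - it_x s k| <=
    kap * E `^ (th - theta) * ((psi p (it_x s k) - optimal_value p) `^ (1 - th)).
  have [z Sz hz] := hkap _ (iO k); exists z => //; rewrite distrC.
  apply: (le_trans hz); rewrite -mulrA ler_pM2l//.
  set e := psi p _ - _; have e0 : 0 <= e by rewrite subr_ge0; exact: opt_le.
  have thE : (th - theta) + (1 - th) = 1 - theta by ring.
  rewrite -thE powRD; last by rewrite thE subr_eq0 (gt_eqF htheta1).
  rewrite ler_wpM2r ?powR_ge0//; apply: powR_ler => //; first exact: E1.
  by rewrite subr_ge0.
have kap'0 : 0 < kap * E `^ (th - theta) by rewrite mulr_gt0// powR_gt0.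
have hvis := run_stop_visited hrun.
have tp k z : psi p (it_x s k.+1) + curvature s k (it_i s k) (it_j s k) / 2 *
    `|z - it_x s k.+1| ^+ 2 <= psi p z + it_lam s k (it_i s k) (it_j s k) *
    g_smoothed p h (it_mu s k) z + curvature s k (it_i s k) (it_j s k) / 2 *
    `|z - it_x s k| ^+ 2 + Lf * `|it_x s k.+1 - it_x s k| ^+ 2.
  rewrite (run_next hrun).
  exact: (trial_three_point hX hY hA hBcompact hBbase hB hLmin hrun hD z (hvis k)).
have delta0 : 0 < - g_smoothed p h (it_mu s 0%N) x0.
  by rewrite oppr_gt0; exact: run_g0 hrun.
have gx0 k : g_smoothed p h (it_mu s k) x0 <= - - g_smoothed p h (it_mu s 0%N) x0.
  by rewrite opprK; exact: (g_le0 hB hrun).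
have gS k z : solution_set p z -> g_smoothed p h (it_mu s k) z <= alpha3 * it_mu s k.
  move=> [fz _].
  exact: (g_le_feasible hY hA hBcompact hBbase hB (mu_gt0 hrun k) fz).
have [C C0 hCt] := iterates_tail (B_alpha3 hB) delta0 (A_Lf hA) hLmin Lbar0 c0 E0
  (mu_gt0 hrun) (mu_le0 hrun) (fun k => lam_ge0 hrun (hvis k))
  (fun k => curvature_ge hLmin hrun (hvis k)) M_gev M_le tp hdesc
  (fun k => opt_le _ (iO k)) (fun k => E1 _ (iO k)) gx0 (E1 _ Ox0)
  (fun k => hDm _ _ Ox0 (iO k)) optE gS th2 th1 kap'0 EB' r2 r1 c10 c20 hmu s0 sr sth.
case: (hX) => _ [n [b sb]].
have cD : compact [set z : X | `|z| <= `|x0| + D].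
  apply: (fin_dim_compact sb).
    exists (`|x0| + D); split; first by rewrite num_real.
    by move=> y hy z /= hz; rewrite (le_trans hz)// ltW.
  by apply: (@closed_comp _ _ (fun z : X => `|z|) [set t | t <= `|x0| + D]);
    [move=> z _; exact: norm_continuous | exact: closed_le].
have inD k : [set z : X | `|z| <= `|x0| + D] (it_x s k).
  rewrite /= -(subrK x0 (it_x s k)) addrC (le_trans (ler_normD _ _))// lerD2l.
  exact: hDm (iO k) Ox0.
have [xs [xs_lim xs_rate]] := tail_bound_cvg cD inD C0 s0 hCt.
by exists xs; split => //; exists k0, C.
Qed.
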